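(* Let $n\ge2$ and let $\lambda$ be a partition of $n$ with transpose $\lambda^t$. The elliptic fake degree of $[\lambda\times\emptyset]\in\overline R(W(D_n))$ is $$F^{D_n}_{[\lambda\times\emptyset]}=\frac{(q-1)^n}{\prod_{(i,j)\in\lambda}(1-q^{2h(i,j)})}\left(q^{2n(\lambda)}\prod_{(i,j)\in\lambda}(1-q^{2c(i,j)+1})+(-1)^n q^{2n(\lambda^t)}\prod_{(i',j')\in\lambda^t}(1-q^{2c(i',j')+1})\right).$$
   Context: $W(D_n)\subset W(B_n)$ is the index-two subgroup of the hyperoctahedral group consisting of signed permutations with an even number of sign changes; both act on $E=\mathbb R^n$. The irreducible $S_n$-representation attached to $\lambda$ is $\sigma_\lambda$ ($\sigma_{(n)}$ trivial, $\sigma_{(1^n)}=\mathrm{sgn}$). The $W(B_n)$-representation $\lambda\times\emptyset$ is the inflation of $\sigma_\lambda$ through $W(B_n)\to S_n$; its restriction to $W(D_n)$ is again denoted $\lambda\times\emptyset$. For $W=W(D_n)$ the elliptic pairing on the Grothendieck group $R(W)$ is $\langle\sigma,\sigma'\rangle^{\mathrm{ell}}_W=\frac1{|W|}\sum_{w\in W}\sigma(w)\sigma'(w)\det_E(1-w)$, and $\overline R(W)=R(W)/\mathrm{rad}\langle\,,\,\rangle^{\mathrm{ell}}_W$. The elliptic fake degree of $[\pi]\in\overline R(W)$ is $F_{[\pi]}=\frac{(q-1)^{n}}{|W|}\sum_{w\in W}\pi(w)\frac{\det_E(1-w)}{\det_E(1-qw)}\in\mathbb Q(q)$. For a partition $\lambda$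 viewed as a Young diagram (box $(i,j)$ in row $i$, column $j$): $n(\lambda)=\sum_i(i-1)\lambda_i$, $c(i,j)=j-i$, and $h(i,j)$ is the hook length. *)

(* Defs.v *)
From HB Require Import structures.
From mathcomp Require Import all_boot all_order all_fingroup all_algebra.
From mathcomp Require Import all_solvable all_field all_character.

Set Implicit Arguments.
Unset Strict Implicit.
Unset Printing Implicit Defensive.

Import GroupScope Order.TTheory GRing.Theory Num.Theory.
Local Open Scope ring_scope.

(** * Partitions and Young diagrams *)

Definition is_partition (n : nat) (la : seq nat) : bool :=
  [&& sorted geq la, 0%N \notin la & sumn la == n].

Definition conj_part (la : seq nat) : seq nat :=
  [seq count (fun l => j < l)%N la | j <- iota 0 (head 0%N la)].

(* Boxes are indexed from 0: the box (i, j) of [boxes la] lies in row i.+1 and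
   column j.+1 of the diagram.  Contents and hook lengths are unaffected. *)
Definition boxes (la : seq nat) : seq (nat * nat) :=
  [seq (i, j) | i <- iota 0 (size la), j <- iota 0 (nth 0%N la i)].

Definition content (b : nat * nat) : int := b.2%:Z - b.1%:Z.

Definition hook (la : seq nat) (b : nat * nat) : nat :=
  ((nth 0 la b.1 - b.2.+1) + (nth 0 (conj_part la) b.2 - b.1.+1) + 1)%N.

Definition n_stat (la : seq nat) : nat :=
  (\sum_(i < size la) i * nth 0 la i)%N.

(** * The irreducible representation sigma_la of S_n *)

(* The boxes of la are filled with 0, ..., n - 1 in reading order, so that k
   sits in row [reshape_index la k] and column [reshape_offset la k]. *)
Definition row_stab (n : nat) (la : seq nat) : {set 'S_n} :=
  [set s : 'S_n | [forall k : 'I_n, reshape_index la (s k) == reshape_index la k]].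

Definition col_stab (n : nat) (la : seq nat) : {set 'S_n} :=
  [set s : 'S_n | [forall k : 'I_n, reshape_offset la (s k) == reshape_offset la k]].

Definition regS (n : nat) := regular_repr algC [set: 'S_n].

(* The element of the group algebra of S_n, as a vector of the regular
   representation. *)
Definition young_symmetrizer (n : nat) (la : seq nat) :=
  gring_row (\sum_(r in row_stab n la) \sum_(c in col_stab n la)
               (-1) ^+ odd_perm c *: regS n (r * c)%g).

(* Specht module: the (right) ideal of the group algebra generated by the Young
   symmetrizer.  With this convention sigma_(n) is trivial and sigma_(1^n) is
   the sign representation. *)
Definition specht_repr (n : nat) (la : seq nat) :=
  submod_repr (cyclic_mx_module (regS n) (young_symmetrizer n la)).

(** * Signed permutations *)

(* The signed permutation w sends the basis vector e_i of E to e_(sperm_perm w i)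
   if [sperm_sign w i] is false, and to its opposite otherwise.  As for
   permutations, (v * w) is v followed by w, i.e. groups act on the right. *)
Record sperm (n : nat) := SPerm {
  sperm_sign : {ffun 'I_n -> bool};
  sperm_perm : 'S_n
}.

Section SignedPermutations.
Variable n : nat.
Implicit Types v w : sperm n.

Definition sperm_pair w := (sperm_sign w, sperm_perm w).
Definition pair_sperm (p : {ffun 'I_n -> bool} * 'S_n) := SPerm p.1 p.2.
Lemma sperm_pairK : cancel sperm_pair pair_sperm. Proof. by case. Qed.

HB.instance Definition _ := Finite.copy (sperm n) (can_type sperm_pairK).

Definition sperm_one : sperm n := SPerm [ffun=> false] 1%g.

Definition sperm_mul v w : sperm n :=
  SPerm [ffun i => sperm_sign v i (+) sperm_sign w (sperm_perm v i)]
        (sperm_perm v * sperm_perm w)%g.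

Definition sperm_inv w : sperm n :=
  SPerm [ffun i => sperm_sign w ((sperm_perm w)^-1%g i)] (sperm_perm w)^-1%g.

Lemma sperm_mulA : associative sperm_mul.
Proof.
move=> u v w; congr SPerm; last by rewrite /= mulgA.
by apply/ffunP=> i; rewrite !ffunE /= permM addbA.
Qed.

Lemma sperm_mul1 : left_id sperm_one sperm_mul.
Proof.
case=> s p; congr SPerm; last by rewrite /= mul1g.
by apply/ffunP=> i; rewrite !ffunE /= perm1.
Qed.

Lemma sperm_mulV : left_inverse sperm_one sperm_inv sperm_mul.
Proof.
case=> s p; congr SPerm; last by rewrite /= mulVg.
by apply/ffunP=> i; rewrite !ffunE /= addbb.
Qed.

HB.instance Definition _ :=
  Finite_isGroup.Build (sperm n) sperm_mulA sperm_mul1 sperm_mulV.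

(* The matrix of w on E, acting on row vectors. *)
Definition sperm_mx (R : pzRingType) w : 'M[R]_n :=
  \matrix_(i, j) ((-1) ^+ sperm_sign w i *+ (sperm_perm w i == j)).

Lemma sperm_mx_repr (R : comUnitRingType) :
  mx_repr [set: sperm n] (sperm_mx R).
Proof.
split=> [|v w _ _]; apply/matrixP=> i j.
  by rewrite !mxE ffunE perm1.
rewrite !mxE (bigD1 (sperm_perm v i)) //= big1 => [|k nk].
  rewrite !mxE eqxx ffunE permM addr0 mulr1n signr_addb.
  by rewrite -mulrnAr.
by rewrite !mxE eq_sym (negPf nk) mulr0n mul0r.
Qed.

Definition WB : {group sperm n} := [group of [set: sperm n]].

Definition nb_sign_changes w : nat := #|[set i | sperm_sign w i]|.

Definition WD_set : {set sperm n} := [set w | ~~ odd (nb_sign_changes w)].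

Lemma odd_nb_sign_changes w :
  odd (nb_sign_changes w) = \big[addb/false]_i sperm_sign w i.
Proof.
rewrite /nb_sign_changes -sum1dep_card (big_morph odd oddD (erefl : odd 0 = false)).
by rewrite big_mkcond /=; apply: eq_bigr => i _; case: (sperm_sign w i).
Qed.

Lemma WD_group_set : group_set WD_set.
Proof.
apply/group_setP; split=> [|v w].
  by rewrite inE odd_nb_sign_changes big1 // => i _; rewrite ffunE.
rewrite !inE !odd_nb_sign_changes => /negPf v0 /negPf w0.
under eq_bigr do rewrite ffunE.
rewrite big_split /= v0 /=.
by rewrite (reindex_inj (@perm_inj _ (sperm_perm v))) /= in w0; rewrite w0.
Qed.

Canonical WD : {group sperm n} := group WD_group_set.

Lemma sperm_permM :
  {in WB &, {morph @sperm_perm n : v w / (v * w)%g >-> (v * w)%g}}.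
Proof. by []. Qed.

(* The projection W(B_n) -> S_n. *)
Canonical sperm_perm_morphism := Morphism sperm_permM.

Lemma WB_sub : WB \subset @sperm_perm n @*^-1 [set: 'S_n].
Proof. by apply/subsetP=> w _; rewrite !inE. Qed.

Lemma WD_sub : WD \subset WB.
Proof. exact: subsetT. Qed.

End SignedPermutations.

Arguments sperm_mx {n} R w.

Definition part_empty_repr_B (n : nat) (la : seq nat) :=
  subg_repr (morphpre_repr (sperm_perm_morphism n) (specht_repr n la))
            (WB_sub n).

Definition part_empty_repr_D (n : nat) (la : seq nat) :=
  subg_repr (part_empty_repr_B n la) (WD_sub n).

(** * The Grothendieck group R(W) and its elliptic quotient *)

(* R(W) is the group of virtual characters; it is stated for an arbitrary
   subgroup W of the hyperoctahedral group. *)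
Record vchar (n : nat) (W : {group sperm n}) := VChar {
  vchar_val :> 'CF(W);
  _ : vchar_val \in 'Z[irr W]
}.

HB.instance Definition _ n (W : {group sperm n}) :=
  [isSub for @vchar_val n W].
HB.instance Definition _ n (W : {group sperm n}) :=
  [Choice of vchar W by <:].
HB.instance Definition _ n (W : {group sperm n}) :=
  [SubChoice_isSubZmodule of vchar W by <:].

Definition repr_vchar n (W : {group sperm n}) d
    (rW : mx_representation algC W d) : vchar W :=
  VChar (char_vchar (cfRepr_char rW)).

Definition vchar_irr n (W : {group sperm n}) (i : Iirr W) : vchar W :=
  VChar (irr_vchar i).

(* det_E(1 - q w) *)
Definition detE n (R : comNzRingType) (q : R) (w : sperm n) : R :=
  \det (1%:M - q *: sperm_mx R w).

Definition ell_pair n (W : {group sperm n}) (s t : vchar W) : algC :=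
  (#|W|%:R)^-1 * \sum_(w in W) s w * t w * detE 1 w.

(* The radical; by [ell_radP] it may be tested on irreducible characters. *)
Definition ell_rad n (W : {group sperm n}) : {pred vchar W} :=
  [pred s | [forall i : Iirr W, ell_pair s (vchar_irr i) == 0]].


Arguments ell_rad {n} W _ : simpl never.

Section Elliptic.
Variables (n : nat) (W : {group sperm n}).
Implicit Types s t : vchar W.

Lemma detE_conj (R : comUnitRingType) (q : R) (v w : sperm n) :
  detE q (w ^ v)%g = detE q w.
Proof.
rewrite /detE; have [M1 MM] := sperm_mx_repr n R.
have VM : sperm_mx R v^-1%g *m sperm_mx R v = 1%:M.
  by rewrite -MM ?inE // mulVg.
have -> : 1%:M - q *: sperm_mx R (w ^ v)%g =
   sperm_mx R v^-1%g *m (1%:M - q *: sperm_mx R w) *m sperm_mx R v.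
  rewrite conjgE !MM ?inE // mulmxBr mulmxBl mulmx1 VM.
  by rewrite -scalemxAr -scalemxAl mulmxA.
by rewrite 2!det_mulmx mulrAC -det_mulmx VM det1 mul1r.
Qed.

Lemma ell_class_fun (s : vchar W) :
  is_class_fun <<W>> [ffun w => (s w * detE 1 w)^*].
Proof.
rewrite genGid; apply: intro_class_fun => [w v Ww Wv | w nWw].
  by rewrite cfunJ // detE_conj.
by rewrite cfun0 // mul0r conjC0.
Qed.

Lemma ell_rad_vanish s w : s \in ell_rad W -> w \in W -> s w * detE 1 w = 0.
Proof.
move=> /forallP s0 Ww.
pose phi := Cfun 0 (ell_class_fun s).
have phiE v : phi v = (s v * detE 1 v)^* by rewrite cfunE.
suff phi0 : phi = 0.
  by apply/eqP; rewrite -conjC_eq0 -phiE phi0 cfunE.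
rewrite (cfun_sum_cfdot phi) big1 // => i _.
suff -> : '[phi, 'chi_i] = 0 by rewrite scale0r.
rewrite cfdotC -[RHS]conjC0; congr (_^*); move/eqP: (s0 i) => <-.
rewrite cfdotE; congr (_ * _); apply: eq_bigr => v _.
by rewrite phiE conjCK mulrA [_ * s v]mulrC.
Qed.

Lemma ell_radP s :
  reflect (forall t, ell_pair s t = 0) (s \in ell_rad W).
Proof.
apply: (iffP idP) => [s0 t | s0]; last by apply/forallP=> i; rewrite s0.
rewrite /ell_pair big1 ?mulr0 // => w Ww.
by rewrite mulrAC ell_rad_vanish ?mul0r.
Qed.

Lemma ell_rad_zmod_closed : zmod_closed (ell_rad W).
Proof.
split=> [|s t s0 t0]; apply/ell_radP => u; rewrite /ell_pair big1 ?mulr0 // => w Ww.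
  by rewrite /= cfunE !mul0r.
by rewrite /= !cfunE mulrAC mulrBl !ell_rad_vanish // subrr mul0r.
Qed.

HB.instance Definition _ :=
  GRing.isZmodClosed.Build (vchar W) (ell_rad W) ell_rad_zmod_closed.

Definition Rbar := {ideal_quot (ell_rad W)}.

End Elliptic.

Definition ell_class n (W : {group sperm n}) (s : vchar W) : Rbar W :=
  \pi_(Rbar W)%qT s.

(** * Elliptic fake degrees *)

(* Characters take their values in algC, so the field Q(q) is enlarged to
   algC(q), whose indeterminate is [qq]. *)
Definition Kq := {fraction {poly algC}}.

Definition qq : Kq := @FracField.tofrac _ 'X.

Definition constK (c : algC) : Kq := @FracField.tofrac _ c%:P.

Definition fake_degree_sum n (W : {group sperm n}) (s : vchar W) : Kq :=
  (qq - 1) ^+ n / #|W|%:R *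
  \sum_(w in W) constK (s w) * (detE 1 w / detE qq w).

Definition ell_fake_degree n (W : {group sperm n}) (x : Rbar W) : Kq :=
  fake_degree_sum (generic_quotient.repr x).

Lemma constK_detE n (w : sperm n) : constK (detE 1 w) = detE 1 w.
Proof.
rewrite /constK /detE -det_map_mx -det_map_mx; congr (\det _).
apply/matrixP=> i j; rewrite !mxE !mul1r.
by rewrite !rmorphB /= !rmorphMn /= !rmorphXn /= !rmorphN !rmorph1.
Qed.

Lemma fake_degree_sum_rad n (W : {group sperm n}) (s t : vchar W) :
  s - t \in ell_rad W -> fake_degree_sum s = fake_degree_sum t.
Proof.
move=> st; congr (_ * _); apply: eq_bigr => w Ww.
rewrite !mulrA -constK_detE -!(rmorphM (@FracField.tofrac _)) -!polyCM; congr (FracField.tofrac _%:P / _).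
apply/eqP; rewrite -subr_eq0 -mulrBl.
by have := ell_rad_vanish st Ww; rewrite /= !cfunE => ->.
Qed.

(* The elliptic fake degree of a class is computed on any representative. *)
Lemma ell_fake_degreeE n (W : {group sperm n}) (s : vchar W) :
  ell_fake_degree (ell_class s) = fake_degree_sum s.
Proof.
apply: fake_degree_sum_rad; rewrite Quotient.idealrBE.
by rewrite reprK.
Qed.

(* Main.v *)
Require Import Defs.
From mathcomp Require Import all_boot all_order all_fingroup all_algebra.
From mathcomp Require Import all_field all_character.
From mathcomp Require Import zify ring.

(* On the signed permutations w over a fixed s in S_n, det(1 - w) vanishes unless
   all cycles of w are negative, so that averaging over W(D_n) gives
     1/n! \sum_s chi_lambda(s) (1 + (-1)^#cycles(s)) / \prod_cycles (1 + q^m).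
   Both terms are values, at t = q and t = 1/q, of
     1/n! \sum_s chi_lambda(s) \prod_cycles (1 - t^m) / (1 - (q^2)^m),
   the Schur function with p_m replaced by (1 - t^m) / (1 - (q^2)^m).  This is a
   polynomial in t; for t = (q^2)^M it is the Schur polynomial of lambda at
   1, q^2, ..., (q^2)^(M-1), a quotient of two Vandermonde determinants.

   That chi_lambda, the character of the Specht module, has the Schur function
   as Frobenius characteristic is shown by comparing it with
   omega_lambda(s) = [x^(lambda+delta)] a_delta(x) p_s(x).  Pieri's rule shows
   that the omega_lambda are orthonormal; von Neumann's lemma on Young
   symmetrizers gives <chi, chi> = 1 and, with the triangularity of the
   multiplicities of chi in Young permutation modules, <chi, omega> = 1. *)

(** For a cycle of length m, t = q gives (1 - q^m) / (1 - q^(2m)) = 1 / (1 + q^m), and t = 1/q gives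
    -q^(-m) / (1 + q^m): the minus signs collect to (-1)^#cycles and the powers of q to q^(-n).
    Neither t is a power of q^2, so the principal specialization alone is not enough and
    polynomiality in t is essential. At t = 1/q a box of content c contributes 1 - q^(2c-1), a
    monomial times the factor 1 - q^(1-2c) of the transposed box; this is how the transpose of
    lambda enters. No ring of symmetric functions is built. Identities are read off coefficient by
    coefficient, the coefficients being counts of functions from n points to N + 1 colours that are
    fixed by s, with N + 1 at least the number of rows. It need not be known in advance that
    omega_lambda is a character: the squared norm of chi - omega is 1 - 1 - 1 + 1 = 0, which already
    forces equality. *)

Set Implicit Arguments.
Unset Strict Implicit.
Unset Printing Implicit Defensive.

Import Order.TTheory GRing.Theory Num.Theory.
Local Open Scope ring_scope.

(** * Functions on {0, ..., n-1} up to permutation *)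

Section FunctionTypes.
Variables (n : nat) (I : finType).
Implicit Types (f g : {ffun 'I_n -> I}) (s : 'S_n).

Definition ftype f (i : I) : nat := #|[set k | f k == i]|.

Definition fperm f s : {ffun 'I_n -> I} := [ffun k => f (s k)].

Lemma fperm1 f : fperm f 1%g = f.
Proof. by apply/ffunP=> k; rewrite ffunE perm1. Qed.

Lemma fpermM f s t : fperm f (s * t)%g = fperm (fperm f t) s.
Proof. by apply/ffunP=> k; rewrite !ffunE permM. Qed.

Lemma fpermK s : cancel (fperm^~ s) (fperm^~ s^-1%g).
Proof. by move=> f; rewrite -fpermM mulVg fperm1. Qed.

Lemma fpermVK s : cancel (fperm^~ s^-1%g) (fperm^~ s).
Proof. by move=> f; rewrite -fpermM mulgV fperm1. Qed.

Lemma fperm_inj s : injective (fperm^~ s).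
Proof. exact: can_inj (fpermK s). Qed.

Lemma fperm_fixV f s : (fperm f s^-1%g == f) = (fperm f s == f).
Proof. by rewrite -(inj_eq (@fperm_inj s)) fpermVK eq_sym. Qed.

Lemma sum_ftype f : (\sum_i ftype f i = n)%N.
Proof.
rewrite -[RHS]card_ord -sum1_card (partition_big f xpredT) //=.
apply: eq_bigr => i _; rewrite /ftype -sum1_card; apply: eq_bigl => k.
by rewrite inE.
Qed.

Lemma ftype_perm f s i : ftype (fperm f s) i = ftype f i.
Proof.
rewrite /ftype -[RHS](card_preimset _ (@perm_inj _ s)); apply: eq_card => k.
by rewrite !inE ffunE.
Qed.

Lemma ftype_count f i : ftype f i = count_mem i [seq f k | k <- enum 'I_n].
Proof.
rewrite /ftype cardE count_map -size_filter [enum 'I_n]enumT /enum_mem.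
by congr size; apply: eq_filter => k; rewrite /= inE.
Qed.

Lemma ftype_eqP f g :
  (forall i, ftype f i = ftype g i) -> exists s, g = fperm f s.
Proof.
move=> fg.
have /tuple_permP[s gs] : perm_eq [tuple g i | i < n] [tuple f i | i < n].
  by apply/allP=> i _; rewrite /= -!ftype_count fg.
exists s; apply/ffunP=> k; rewrite ffunE.
have /(congr1 (fun t => nth (g k) t k)) := gs.
by rewrite -!tnth_nth !tnth_mktuple.
Qed.

Lemma ftype_ex (tau : I -> nat) :
  (\sum_i tau i = n)%N -> exists f, forall i, ftype f i = tau i.
Proof.
move=> tn; pose r := flatten [seq nseq (tau i) i | i <- enum I].
have sr : size r == n.
  rewrite size_flatten /shape -map_comp sumnE big_map big_enum /= -tn.
  by apply/eqP/eq_bigr => i _; rewrite size_nseq.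
exists [ffun k => tnth (Tuple sr) k] => i.
have -> : tau i = count_mem i r.
  rewrite count_flatten -map_comp sumnE big_map big_enum /= (bigD1 i) //=.
  rewrite count_nseq /= eqxx mul1n big1 ?addn0 // => j /negPf nj.
  by rewrite count_nseq /= nj.
rewrite ftype_count; congr (count_mem i _).
rewrite -[r]/(tval (Tuple sr)) -[in RHS]map_tnth_enum.
by apply: eq_map => k; rewrite ffunE.
Qed.

(** Orbit counting: the functions of type [tau] form one orbit, and the stabilizer of each f is a
    translate of the set of permutations carrying a base point [f0] to f. These sets partition
    S_n. *)
Lemma burnside_ftype (tau : I -> nat) : (\sum_i tau i = n)%N ->
  (\sum_(s : 'S_n) #|[set f | (fperm f s == f) && [forall i, ftype f i == tau i]]|
     = n`!)%N.
Proof.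
move=> /ftype_ex[f0 f0E].
have tE f s : f = fperm f0 s -> forall i, ftype f i = tau i.
  by move=> -> i; rewrite ftype_perm.
transitivity (\sum_(f | [forall i, ftype f i == tau i]) #|[set s | fperm f0 s == f]|)%N.
  under [LHS]eq_bigr do rewrite -sum1dep_card.
  rewrite (exchange_big_dep (fun f => [forall i, ftype f i == tau i])) /=; last first.
    by move=> s f _ /andP[].
  apply: eq_bigr => f tf.
  have [p fp] : exists p, f = fperm f0 p.
    by apply: ftype_eqP => i; rewrite f0E (eqP (forallP tf i)).
  rewrite sum1dep_card -(card_imset _ (@mulIg _ p)).
  apply: eq_card => s; apply/imsetP/idP.
    case=> t; rewrite !inE tf andbT => /eqP ft ->.
    by rewrite fpermM -fp ft.
  rewrite inE => /eqP fs; exists (s * p^-1)%g; last by rewrite mulgKV.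
  by rewrite !inE tf andbT {1}fp -!fpermM mulgKV fs.
rewrite -card_Sn -sum1_card (partition_big (fperm f0) (fun f => [forall i, ftype f i == tau i])) /=; last first.
  by move=> s _; apply/forallP=> i; rewrite (tE _ s).
apply: eq_bigr => f _; rewrite sum1dep_card; apply: eq_card => s.
by rewrite !inE.
Qed.

End FunctionTypes.

(** The character of the Young permutation module of shape [nu]. *)
Definition nb_fixed (n : nat) (I : finType) (nu : I -> nat) (s : 'S_n) : nat :=
  #|[set f : {ffun 'I_n -> I} | (fperm f s == f) && [forall i, ftype f i == nu i]]|.

(** A pair of functions fixed by s is one function into [I * J] fixed by s. Its type is a matrix
    with prescribed margins, and by [burnside_ftype] each matrix contributes n!. The condition m +
    type = l avoids truncated subtraction. *)
Lemma burnside_pair (n : nat) (I J : finType) (m l : I -> nat) (nu : J -> nat) :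
  (\sum_j nu j = n)%N ->
  (\sum_(s : 'S_n)
     #|[set f : {ffun 'I_n -> I} |
         (fperm f s == f) && [forall i, m i + ftype f i == l i]]| * nb_fixed nu s =
   n`! * #|[set tau : {ffun J -> {ffun I -> 'I_n.+1}} |
             [forall j, \sum_i tau j i == nu j] &&
             [forall i, m i + \sum_j tau j i == l i]]|)%N.
Proof.
move=> nun.
pose FF := {ffun 'I_n -> I * J}.
pose ty (F : FF) : {ffun J -> {ffun I -> 'I_n.+1}} :=
  [ffun j => [ffun i => inord (ftype F (i, j))]].
pose ok (tau : {ffun J -> {ffun I -> 'I_n.+1}}) :=
   [forall j, \sum_i tau j i == nu j]%N && [forall i, m i + \sum_j tau j i == l i]%N.
have tyE F i j : ty F j i = ftype F (i, j) :> nat.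
  rewrite !ffunE inordK // ltnS.
  by apply: leq_trans (max_card _) _; rewrite card_ord.
have fstE (F : FF) i : (\sum_j ty F j i)%N = ftype [ffun k => (F k).1] i.
  rewrite /ftype -sum1dep_card (partition_big (fun k => (F k).2) xpredT) //=.
  apply: eq_bigr => j _; rewrite tyE /ftype -sum1dep_card; apply: eq_bigl => k.
  by rewrite ffunE; case: (F k) => a b /=; rewrite xpair_eqE.
have sndE (F : FF) j : (\sum_i ty F j i)%N = ftype [ffun k => (F k).2] j.
  rewrite /ftype -sum1dep_card (partition_big (fun k => (F k).1) xpredT) //=.
  apply: eq_bigr => i _; rewrite tyE /ftype -sum1dep_card; apply: eq_bigl => k.
  by rewrite ffunE; case: (F k) => a b /=; rewrite xpair_eqE andbC.
transitivity (\sum_(s : 'S_n) #|[set F : FF | (fperm F s == F) && ok (ty F)]|)%N.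
  apply: eq_bigr => s _; rewrite /nb_fixed -cardsX.
  pose mk (p : {ffun 'I_n -> I} * {ffun 'I_n -> J}) : FF := [ffun k => (p.1 k, p.2 k)].
  have mk_inj : injective mk.
    move=> [f g] [f' g'] /ffunP e; congr (_, _); apply/ffunP=> k;
    by have := e k; rewrite !ffunE /= => -[].
  rewrite -(card_imset _ mk_inj); apply: eq_card => F.
  have mkfix p : (fperm (mk p) s == mk p) = (fperm p.1 s == p.1) && (fperm p.2 s == p.2).
    apply/eqP/andP => [e | [/eqP/ffunP e1 /eqP/ffunP e2]].
      by split; apply/eqP/ffunP=> k; have /ffunP/(_ k) := e; rewrite !ffunE => -[].
    apply/ffunP=> k; rewrite !ffunE; congr (_, _).
      by have := e1 k; rewrite ffunE.
    by have := e2 k; rewrite ffunE.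
  have mk1 p : [ffun k => (mk p k).1] = p.1 by apply/ffunP=> k; rewrite !ffunE.
  have mk2 p : [ffun k => (mk p k).2] = p.2 by apply/ffunP=> k; rewrite !ffunE.
  have mkok p : ok (ty (mk p)) =
      [forall j, ftype p.2 j == nu j] && [forall i, m i + ftype p.1 i == l i]%N.
    rewrite /ok; congr (_ && _); apply: eq_forallb => x; first by rewrite sndE mk2.
    by rewrite fstE mk1.
  apply/imsetP/idP => [[p] | ].
    rewrite !inE => /andP[/andP[f1 t1] /andP[f2 t2]] ->.
    by rewrite mkfix mkok f1 f2 t1 t2.
  rewrite inE => FP.
  have FE : F = mk ([ffun k => (F k).1], [ffun k => (F k).2]).
    by apply/ffunP=> k; rewrite !ffunE; case: (F k).
  exists ([ffun k => (F k).1], [ffun k => (F k).2]) => //.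
  move: FP; rewrite FE mkfix mkok !mk1 !mk2 !inE /=.
  by move=> /andP[/andP[-> ->] /andP[-> ->]].
transitivity (\sum_(s : 'S_n) \sum_(tau | ok tau)
   #|[set F : FF | (fperm F s == F) && [forall i, ftype F i == tau i.2 i.1]]|)%N.
  apply: eq_bigr => s _.
  rewrite -sum1dep_card (partition_big ty ok) /=; last by move=> F /andP[].
  apply: eq_bigr => tau okt; rewrite sum1dep_card; apply: eq_card => F.
  rewrite !inE -andbA; congr (_ && _); apply/andP/forallP.
    by move=> [_ /eqP <-] [i j]; rewrite tyE.
  move=> e; have -> : ty F = tau; last by rewrite eqxx.
  by apply/ffunP=> j; apply/ffunP=> i; apply: val_inj; rewrite /= tyE (eqP (e (i, j))).
rewrite exchange_big /= mulnC -sum_nat_const; apply: eq_big => [tau | tau okt].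
  by rewrite inE.
have /andP[/forallP t1 _] := okt.
apply: burnside_ftype; rewrite -(pair_bigA _ (fun i j => tau j i : nat)) /= exchange_big /=.
by rewrite -[RHS]nun; apply: eq_bigr => j _; rewrite (eqP (t1 j)).
Qed.

(** * Pieri's rule for shifted partitions *)

Section Pieri.
Variables (N L : nat).
Local Notation T := {ffun 'I_N -> 'I_L}.
Implicit Types (m l : T) (A : T -> algC).

Definition weight m : nat := (\sum_i m i)%N.

Definition antisymmetric_fun A :=
  forall m (w : 'S_N), A (fperm m w) = (-1) ^+ odd_perm w * A m.

Definition strictly_decreasing l := forall i j : 'I_N, (i < j -> l j < l i)%N.

(* If A m is the coefficient of x^m in a power series a(x), then [pieri k A l]
   is the coefficient of x^l in h_k(x) a(x), for the complete symmetric
   function h_k. *)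
Definition pieri (k : nat) A l : algC :=
  \sum_(m : T | [forall i, m i <= l i]%N && (weight m + k == weight l)%N) A m.

(* The parts lambda_i of the partition whose shift lambda + delta is l, for
   delta = (N - 1, ..., 1, 0). *)
Definition part l (i : nat) : nat := oapp (fun j : 'I_N => l j - (N.-1 - j))%N 0 (insub i).

Lemma weight_perm m w : weight (fperm m w) = weight m.
Proof.
rewrite /weight [RHS](reindex_inj (@perm_inj _ w)).
by apply: eq_bigr => i _; rewrite ffunE.
Qed.

Lemma antisymmetric_pieri k A :
  antisymmetric_fun A -> antisymmetric_fun (pieri k A).
Proof.
move=> antiA l w; rewrite /pieri big_distrr (reindex_inj (@fperm_inj _ _ w)) /=.
apply: eq_big => [m | m _]; last exact: antiA.
rewrite !weight_perm; congr (_ && _); apply/forallP/forallP => ml i.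
  by have := ml (w^-1 i)%g; rewrite !ffunE permKV.
by rewrite !ffunE.
Qed.

End Pieri.

(** After position i come N.-1 - i further entries, strictly decreasing and all below l i. *)
Lemma sdec_ge (N L : nat) (l : {ffun 'I_N -> 'I_L}) :
  strictly_decreasing l -> forall i : 'I_N, (N.-1 - i <= l i)%N.
Proof.
move=> ld i.
have: forall d (j : 'I_N), (N.-1 - j = d -> d <= l j)%N.
  elim=> // d IH j jd.
  have jN : (j.+1 < N)%N by lia.
  apply: leq_ltn_trans (ld j (Ordinal jN) _) => //.
  by apply: IH => /=; lia.
exact.
Qed.

Section PieriPeel.
Variables (N L : nat).
Local Notation T := {ffun 'I_N.+1 -> 'I_L.+1}.
Implicit Types (m l : T).

(** The shift of the partition whose first part is deleted and replaced by a zero part at the end. A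
    part that moves up one row meets an entry of delta larger by one, hence the successor. *)
Definition remove_part l : T :=
  [ffun i => if unlift ord_max i is Some j then inord (l (lift ord0 j)).+1 else ord0].

Lemma remove_partE l (j : 'I_N) : strictly_decreasing l ->
  remove_part l (lift ord_max j) = (l (lift ord0 j)).+1 :> nat.
Proof.
move=> ld; rewrite ffunE liftK inordK //.
have lt_l : (l (lift ord0 j) < l (lift ord_max j))%N.
  by apply: ld; rewrite /= /bump [(N <= j)%N]leqNgt ltn_ord.
by apply: leq_ltn_trans lt_l _.
Qed.

Lemma remove_part_max l : remove_part l ord_max = ord0.
Proof. by rewrite ffunE unlift_none. Qed.


Lemma remove_part_sdec l :
  strictly_decreasing l -> strictly_decreasing (remove_part l).
Proof.
move=> ld i j ij.
have ni : i != ord_max by apply: contraTneq ij => ->; rewrite -leqNgt -ltnS.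
case: (unliftP ord_max i) ni ij => [i' -> _ | ->]; last by rewrite eqxx.
case: (unliftP ord_max j) => [j' -> | -> _]; last first.
  by rewrite remove_part_max remove_partE.
move=> ij; rewrite !remove_partE // ltnS; apply: ld.
by move: ij; rewrite /= /bump; have := ltn_ord i'; have := ltn_ord j'; lia.
Qed.

Lemma part_remove_part l i :
  strictly_decreasing l -> part (remove_part l) i = part l i.+1.
Proof.
move=> ld; rewrite /part.
case: (ltngtP i N) => [iN | iN | ->].
- have i1 : (i < N.+1)%N by lia.
  have i2 : (i.+1 < N.+1)%N by [].
  rewrite !insubT /=.
  have -> : Sub i i1 = lift ord_max (Ordinal iN) :> 'I_N.+1.
    by apply: val_inj; rewrite /= /bump [(N <= _)%N]leqNgt iN.
  have -> : Sub i.+1 i2 = lift ord0 (Ordinal iN) :> 'I_N.+1 by apply: val_inj.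
  by rewrite remove_partE //; lia.
- by rewrite !insubF //; lia.
rewrite insubT // insubF ?ltnn //= => i1.
have -> : Sub N i1 = ord_max :> 'I_N.+1 by apply: val_inj.
by rewrite remove_part_max.
Qed.

(* Swapping the entries m_i and m_(i+1) at the first i with m_i <= l_(i+1) is a
   sign-reversing involution; the m that survive satisfy m_i > l_(i+1) for all
   i, which bounds k by the largest part. *)
Lemma pieri_remove_part k A l :
    antisymmetric_fun A -> strictly_decreasing l -> (part l 0 <= k)%N ->
  pieri k A l = (if k == part l 0%N then A (remove_part l) else 0).
Proof.
move=> antiA ld lek.
pose G i m := [forall j : 'I_N, (j < i)%N ==> (l (lift ord0 j) < m (lift ord_max j))%N].
pose S m := [forall i, m i <= l i]%N && (weight m + k == weight l)%N.
have step i : (i <= N)%N -> pieri k A l = \sum_(m | S m && G i m) A m.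
  elim: i => [|i IH] iN.
    by apply: eq_bigl => m; rewrite (_ : G 0%N m = true) ?andbT //; apply/forallP.
  rewrite (IH (ltnW iN)) {IH} (bigID (G i.+1)) /=.
  rewrite [X in _ + X](_ : _ = 0) ?addr0; last first.
    pose i0 := Ordinal iN; set X := (X in X = 0).
    pose t := tperm (lift ord0 i0) (lift ord_max i0).
    have tne : lift ord0 i0 != lift ord_max i0.
      by rewrite -val_eqE /= /bump; lia.
    suff XN : X = - X.
      by apply/eqP; rewrite -eqNr -XN.
    rewrite {1}/X (reindex_inj (@fperm_inj _ _ t)) /= -sumrN.
    apply: eq_big => [m | m _]; last by rewrite antiA odd_tperm tne expr1 mulN1r.
    pose C m := S m && G i m && ~~ G i.+1 m.
    rewrite -/(C _) -/(C m).
    suff CP m' : C m' -> C (fperm m' t).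
      apply/idP/idP => [/CP | /CP //].
      by rewrite -fpermM tperm2 fperm1.
    case/andP => /andP[/andP[/forallP ml wm] /forallP g] ng.
    have viol : (m' (lift ord_max i0) <= l (lift ord0 i0))%N.
      rewrite leqNgt; apply: contra ng => h; apply/forallP=> j; apply/implyP.
      rewrite ltnS leq_eqVlt => /orP[/eqP e | ]; last exact/implyP/g.
      by have -> : j = i0 by apply: val_inj.
    have viol' : (m' (lift ord0 i0) <= l (lift ord0 i0))%N by [].
    apply/andP; split; last first.
      apply/forallPn; exists i0; rewrite /= ltnS leqnn /= -leqNgt.
      by rewrite ffunE tpermR.
    rewrite /S weight_perm wm andbT; apply/andP; split; apply/forallP=> j.
      rewrite ffunE; case: tpermP => [-> | -> | _ _] //.
      apply: leq_trans viol' (ltnW _); apply: ld.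
      by rewrite /= /bump; lia.
    apply/implyP => ji; rewrite ffunE tpermD; first exact: (implyP (g j)).
      by rewrite -val_eqE /= /bump; lia.
    by rewrite -val_eqE /= /bump; have := ltn_ord j; lia.
  apply: eq_bigl => m; rewrite -andbA; congr (_ && _); apply/andP/idP => [[] //| g].
  split=> //; apply/forallP=> j; apply/implyP=> ji.
  by apply: (implyP (forallP g j)); apply: leqW.
rewrite (step N) // {step}.
have l0 : (N <= l ord0)%N by have := sdec_ge ld ord0; rewrite subn0.
have p0 : part l 0 = (l ord0 - N)%N.
  by rewrite /part insubT //= subn0; congr (l _ - _)%N; apply: val_inj.
have wl : weight l = (l ord0 + \sum_(i < N) l (lift ord0 i))%N.
  exact: big_ord_recl.
have wE m : weight m = (\sum_(i < N) m (lift ord_max i) + m ord_max)%N.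
  rewrite /weight big_ord_recr /=; congr (_ + _)%N; apply: eq_bigr => i _.
  by congr (m _ : nat); apply: val_inj; rewrite /= /bump [(N <= _)%N]leqNgt ltn_ord.
have sumS : (\sum_(i < N) (l (lift ord0 i)).+1 = \sum_(i < N) l (lift ord0 i) + N)%N.
  by under eq_bigr do rewrite -addn1; rewrite big_split /= sum1_card card_ord.
(* Adding the N strict inequalities bounds weight m from below and gives k <= l_0 - N = [part l 0].
   Together with the assumed reverse inequality, all of them are equalities. *)
have SG m : S m && G N m -> k = part l 0%N /\ m = remove_part l.
  case/andP => /andP[_ /eqP wm] /forallP g.
  have gi (i : 'I_N) : (l (lift ord0 i) < m (lift ord_max i))%N.
    by apply: (implyP (g i)).
  pose sl := (\sum_(i < N) l (lift ord0 i))%N; pose sm := (\sum_(i < N) m (lift ord_max i))%N.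
  have [] : (sl + N <= sm ?= iff [forall i : 'I_N, (l (lift ord0 i)).+1 == m (lift ord_max i)])%N.
    by rewrite -sumS; apply: leqif_sum => i _; apply: leqif_eq.
  move=> le1 eq1; move: wm; rewrite wl wE -/sl -/sm => wm.
  have ek : k = part l 0%N by lia.
  have m0 : m ord_max = ord0 by apply: val_inj => /=; lia.
  split=> //; apply/ffunP=> i; apply: val_inj => /=.
  case: (unliftP ord_max i) => [j -> | ->]; last by rewrite remove_part_max m0.
  rewrite remove_partE //.
  have /forallP/(_ j)/eqP : [forall i : 'I_N, (l (lift ord0 i)).+1 == m (lift ord_max i)].
    by rewrite -eq1; lia.
  by [].
case: eqP => ek; last by rewrite big_pred0 // => m; apply/negP => /SG[].
rewrite (big_pred1 (remove_part l)) // => m; apply/idP/eqP => [/SG[] // | ->].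
apply/andP; split; last first.
  by apply/forallP=> j; rewrite remove_partE // leqnn implybT.
apply/andP; split; last first.
  rewrite wE remove_part_max addn0 wl; under eq_bigr do rewrite remove_partE //.
  by rewrite sumS; lia.
apply/forallP=> i; case: (unliftP ord_max i) => [j -> | ->]; last by rewrite remove_part_max.
rewrite remove_partE //; apply: ld.
by rewrite /= /bump [(N <= _)%N]leqNgt ltn_ord.
Qed.

End PieriPeel.

(** * Products of complete symmetric functions *)

Section MatrixSum.
Variables (n N L : nat).
Local Notation T := {ffun 'I_N -> 'I_L.+1}.

(** If [A] gives the coefficients of a(x) and all [nu j] are at most n, this is the coefficient of
    x^l in a(x) \prod_j h_(nu j)(x): row j of [tau] is the exponent of a monomial of h_(nu j). *)
Definition matrix_sum (J : nat) (nu : 'I_J -> nat) (A : T -> algC) (l : T) : algC :=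
  \sum_(tau : {ffun 'I_J -> {ffun 'I_N -> 'I_n.+1}} | [forall j, \sum_i tau j i == nu j]%N)
    \sum_(m : T | [forall i, m i + \sum_j tau j i == l i]%N) A m.

Fixpoint iter_pieri (s : seq nat) (A : T -> algC) : T -> algC :=
  if s is k :: s' then pieri k (iter_pieri s' A) else A.

Lemma eq_pieri k (A B : T -> algC) l : A =1 B -> pieri k A l = pieri k B l.
Proof. by move=> AB; apply: eq_bigr. Qed.

Lemma antisymmetric_iter_pieri s A :
  antisymmetric_fun A -> antisymmetric_fun (iter_pieri s A).
Proof. by move=> antiA; elim: s => //= k s; apply: antisymmetric_pieri. Qed.

Lemma matrix_sum0 (nu : 'I_0 -> nat) A l : matrix_sum nu A l = A l.
Proof.
rewrite /matrix_sum (big_pred1 [ffun => [ffun => ord0]]) => [|tau]; last first.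
  transitivity true; first by apply/forallP=> -[].
  by apply/esym/eqP/ffunP=> -[].
rewrite (big_pred1 l) // => m; apply/forallP/eqP => [ml | -> i].
  by apply/ffunP=> i; apply: val_inj; rewrite /= -(eqP (ml i)) big_ord0 addn0.
by rewrite big_ord0 addn0.
Qed.

Lemma matrix_sumS J (nu : 'I_J.+1 -> nat) A l : (nu ord0 <= n)%N ->
  matrix_sum nu A l = pieri (nu ord0) (matrix_sum (fun j => nu (lift ord0 j)) A) l.
Proof.
move=> nun; pose C := {ffun 'I_N -> 'I_n.+1}.
pose mk (p : C * {ffun 'I_J -> C}) : {ffun 'I_J.+1 -> C} :=
  [ffun j => if unlift ord0 j is Some j' then p.2 j' else p.1].
have mk0 p : mk p ord0 = p.1 by rewrite ffunE unlift_none.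
have mkS p (j : 'I_J) : mk p (lift ord0 j) = p.2 j by rewrite ffunE liftK.
have mk_bij : bijective mk.
  exists (fun tau : {ffun 'I_J.+1 -> C} => (tau ord0, [ffun j : 'I_J => tau (lift ord0 j)])) => [[c t] | tau].
    by rewrite mk0; congr (_, _); apply/ffunP=> j; rewrite ffunE mkS.
  apply/ffunP=> j; case: (unliftP ord0 j) => [j' | ] ->; last by rewrite mk0.
  by rewrite mkS ffunE.
rewrite /matrix_sum (reindex mk) /=; last exact: onW_bij.
pose P1 (c : C) := (\sum_i c i == nu ord0)%N.
pose P2 (t : {ffun 'I_J -> C}) := [forall j, \sum_i t j i == nu (lift ord0 j)]%N.
transitivity (\sum_(t | P2 t) \sum_(c | P1 c)
   \sum_(m : T | [forall i, m i + (c i + \sum_j t j i) == l i]%N) A m).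
  rewrite exchange_big /= pair_big /=; apply: eq_big => [[c t] | [c t] _] /=.
    apply/forallP/andP => [h | [/eqP h1 /forallP h2] j].
      split; first by have := h ord0; rewrite mk0.
      by apply/forallP=> j; have := h (lift ord0 j); rewrite mkS.
    case: (unliftP ord0 j) => [j' | ] ->; last by rewrite mk0 /= h1.
    by rewrite mkS.
  apply: eq_bigl => m; apply: eq_forallb => i.
  rewrite big_ord_recl mk0; congr (_ + (_ + _) == _)%N.
  by apply: eq_bigr => j _; rewrite mkS.
rewrite /pieri [RHS]exchange_big /=; apply: eq_bigr => t _.
rewrite (exchange_big_dep xpredT) //= [RHS](exchange_big_dep xpredT) //=.
apply: eq_bigr => m _; rewrite !sumr_const; congr (_ *+ _).
pose toc (l' : T) : C := [ffun i => inord (l i - l' i)].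
pose tol (c : C) : T := [ffun i => inord (l i - c i)].
pose sj i := (\sum_j t j i)%N.
(* With m and the other rows fixed, both sides repeat [A m], as often as there are elements in X and
   in Y. The first row c and the intermediate exponent l' = l - c determine each other. *)
pose X := [set c : C | P1 c & [forall i, m i + (c i + sj i) == l i]%N].
pose Y := [set l' : T | [forall i, l' i <= l i]%N && (weight l' + nu ord0 == weight l)%N
                         & [forall i, m i + sj i == l' i]%N].
have tolE c i : c \in X -> tol c i = (l i - c i)%N :> nat.
  rewrite inE => /andP[_ /forallP/(_ i)/eqP e].
  by rewrite ffunE inordK //; apply: leq_ltn_trans (leq_subr _ _) (ltn_ord _).
have tocE l' i : l' \in Y -> toc l' i = (l i - l' i)%N :> nat.
  rewrite inE => /andP[/andP[/forallP le /eqP w] _].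
  rewrite ffunE inordK // ltnS; apply: leq_trans nun.
  move: w; rewrite /weight (bigD1 i) //= [RHS](bigD1 i) //=.
  have ar a b x y k : (b <= a -> x <= y -> b + x + k = a + y -> a - b <= k)%N by lia.
  by apply: ar (le i) _; apply: leq_sum.
have XY c : c \in X -> tol c \in Y.
  move=> cX; rewrite inE; move: (cX); rewrite inE => /andP[/eqP c1 /forallP c2].
  apply/andP; split; last first.
    by apply/forallP=> i; rewrite (tolE _ _ cX) -(eqP (c2 i)) addnCA addKn.
  apply/andP; split.
    by apply/forallP=> i; rewrite (tolE _ _ cX) leq_subr.
  rewrite /weight -c1 -big_split /=; apply/eqP; apply: eq_bigr => i _.
  by rewrite (tolE _ _ cX) subnK // -(eqP (c2 i)) addnCA leq_addr.
have YX l' : l' \in Y -> toc l' \in X.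
  move=> lY; rewrite inE; move: (lY); rewrite inE => /andP[/andP[/forallP le /eqP w] /forallP e].
  apply/andP; split; last first.
    by apply/forallP=> i; rewrite (tocE _ _ lY) addnCA (eqP (e i)) subnK.
  apply/eqP/(@addnI (weight l')); rewrite w /weight -big_split /=.
  by apply: eq_bigr => i _; rewrite (tocE _ _ lY) subnKC.
have -> : #|[pred c | P1 c & [forall i, m i + (c i + sj i) == l i]%N]| = #|X|.
  by apply: eq_card => c; rewrite !inE.
transitivity #|Y|; last by apply: eq_card => l'; rewrite !inE.
apply/eqP; rewrite eqn_leq; apply/andP; split.
  rewrite -(card_in_imset (f := tol) (D := X)).
    by apply/subset_leq_card/subsetP=> _ /imsetP[c cX ->]; apply: XY.
  move=> c c'; rewrite !inE => /andP[_ /forallP h] /andP[_ /forallP h'] _.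
  apply/ffunP=> i; apply: val_inj; apply/eqP.
  by rewrite /= -(eqn_add2r (sj i)) -(eqn_add2l (m i)) (eqP (h i)) eq_sym h'.
rewrite -(card_in_imset (f := toc) (D := Y)).
  by apply/subset_leq_card/subsetP=> _ /imsetP[c cX ->]; apply: YX.
move=> c c'; rewrite !inE => /andP[_ /forallP h] /andP[_ /forallP h'] _.
by apply/ffunP=> i; apply: val_inj; rewrite /= -(eqP (h i)) (eqP (h' i)).
Qed.

Lemma matrix_sum_iter J (nu : 'I_J -> nat) A l : (forall j, nu j <= n)%N ->
  matrix_sum nu A l = iter_pieri [seq nu j | j <- enum 'I_J] A l.
Proof.
elim: J => [|J IH] in nu l * => nun; first by rewrite enum_ord0 matrix_sum0.
rewrite matrix_sumS // enum_ordSl /= -map_comp; apply: eq_pieri => l'.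
exact: IH.
Qed.

End MatrixSum.

(** * Unitriangularity of iterated Pieri rules *)

Section Lexicographic.
Variables (N L : nat).
Local Notation T := {ffun 'I_N.+1 -> 'I_L.+1}.
Implicit Types (l : T) (A : T -> algC).

(** As long as k is the largest part, [pieri k] just removes that part; the first k exceeding the
    largest remaining part gives zero. This is the vanishing of Kostka numbers off one side of the
    diagonal. *)
Lemma iter_pieri_lex s A l j :
    antisymmetric_fun A -> strictly_decreasing l -> (j < size s)%N ->
    (forall i, i < j -> nth 0 s i = part l i)%N -> (part l j < nth 0 s j)%N ->
  iter_pieri s A l = 0.
Proof.
move=> antiA; elim: s l j => [|k s IH] l j //= ld js eqs ltj.
have antiB := antisymmetric_iter_pieri s antiA.
case: j js eqs ltj => [|j] /= js eqs ltj.
  rewrite pieri_remove_part //; last exact: ltnW.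
  by rewrite gtn_eqF.
have k0 : k = part l 0 by apply: (eqs 0%N).
rewrite pieri_remove_part ?k0 // eqxx.
apply: (IH _ j) => //; first exact: remove_part_sdec.
  by move=> i ij; rewrite part_remove_part //; apply: (eqs i.+1).
by rewrite part_remove_part.
Qed.

(** The diagonal Kostka number is 1: removing all parts of lambda leaves the shift of the empty
    partition, which is the staircase [d]. *)
Lemma iter_pieri_eq s A l (d : T) :
    antisymmetric_fun A -> strictly_decreasing l ->
    (forall i : 'I_N.+1, d i = N - i :> nat)%N ->
    (forall i, nth 0 s i = part l i)%N ->
  iter_pieri s A l = A d.
Proof.
move=> antiA + dE; elim: s l => [|k s IH] l ld eqs /=.
  congr A; apply/ffunP=> i; apply: val_inj => /=; rewrite dE.
  have := eqs i; rewrite nth_nil /part valK /= => /esym/eqP.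
  by rewrite subn_eq0 => li; apply/eqP; rewrite eqn_leq li (sdec_ge ld).
have k0 : k = part l 0 by apply: (eqs 0%N).
rewrite pieri_remove_part ?k0 //; last exact: antisymmetric_iter_pieri.
rewrite eqxx IH //; first exact: remove_part_sdec.
by move=> i; rewrite part_remove_part //; apply: (eqs i.+1).
Qed.

End Lexicographic.

(** * Frobenius' class functions *)

Section Omega.
Variables (n N L : nat).
Hypothesis le_NnL : (N + n <= L)%N.
Local Notation T := {ffun 'I_N.+1 -> 'I_L.+1}.
Implicit Types (l m : T) (s : 'S_n) (w : 'S_N.+1).

(** The exponents of a_delta(x) p_s(x) never exceed N + n, so under [le_NnL] the bounded type [T]
    holds them without truncation. *)
Definition staircase : T := [ffun i : 'I_N.+1 => inord (N - i)].

Lemma staircaseE (i : 'I_N.+1) : staircase i = (N - i)%N :> nat.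
Proof.
rewrite ffunE inordK // ltnS (leq_trans (leq_subr _ _)) //.
exact: leq_trans (leq_addr _ _) le_NnL.
Qed.

Lemma staircase_inj : injective (fperm staircase).
Proof.
move=> w w' /ffunP e; apply/permP=> i; apply: val_inj => /=.
have /(congr1 val) := e i; rewrite /= !ffunE !inordK //; last 2 first.
- by rewrite ltnS; lia.
- by rewrite ltnS; lia.
by have := ltn_ord (w i); have := ltn_ord (w' i); rewrite !ltnS; lia.
Qed.

(* The coefficient of x^m in the alternant a_delta(x). *)
Definition alternant m : algC :=
  \sum_w (-1) ^+ odd_perm w * (m == fperm staircase w)%:R.

Lemma antisymmetric_alternant : antisymmetric_fun alternant.
Proof.
move=> m v; rewrite /alternant (reindex_inj (mulgI v)) big_distrr /=.
apply: eq_bigr => w _; rewrite odd_permM signr_addb mulrA; congr (_ * (_ : bool)%:R).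
by rewrite fpermM (inj_eq (@fperm_inj _ _ v)).
Qed.

Lemma alternant_staircase : alternant staircase = 1.
Proof.
rewrite /alternant (bigD1 1%g) //= odd_perm1 fperm1 eqxx mulr1 big1 ?addr0 // => w nw.
rewrite -{1}[staircase]fperm1 (inj_eq staircase_inj) eq_sym (negPf nw) mulr0 //.
Qed.

(* The coefficient of x^l in a_delta(x) p_s(x), where p_s is the power sum of the
   cycle type of s, expanded as the sum of x^(type of f) over the functions f
   fixed by s: Frobenius' formula for the character of index l - delta. *)
Definition omega l s : algC :=
  \sum_w (-1) ^+ odd_perm w *
    #|[set f : {ffun 'I_n -> 'I_N.+1} |
       (fperm f s == f) && [forall i, staircase (w i) + ftype f i == l i]%N]|%:R.

Lemma omega_alternant l s : omega l s = \sum_m alternant m *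
    #|[set f : {ffun 'I_n -> 'I_N.+1} |
       (fperm f s == f) && [forall i, m i + ftype f i == l i]%N]|%:R.
Proof.
under eq_bigr do rewrite big_distrl.
rewrite exchange_big /=; apply: eq_bigr => w _.
rewrite (bigD1 (fperm staircase w)) //= eqxx mulr1 [X in _ + X]big1 ?addr0.
  congr (_ * _%:R); apply: eq_card => f; rewrite !inE.
  by congr (_ && _); apply: eq_forallb => i; rewrite [fperm _ _ _]ffunE.
by move=> m /negPf ->; rewrite mulr0 mul0r.
Qed.

(** Averaging p_s(x) against the Young permutation character of shape [nu] gives \prod_j h_(nu
    j)(x), by [burnside_pair]; the coefficient of x^l in its product with a_delta is an iterated
    Pieri rule. *)
Lemma omega_nb_fixed l (nu : 'I_N.+1 -> nat) : (\sum_i nu i = n)%N ->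
  \sum_s omega l s * (nb_fixed nu s)%:R =
  n`!%:R * iter_pieri [seq nu j | j <- enum 'I_N.+1] alternant l.
Proof.
move=> nun; have nule j : (nu j <= n)%N by rewrite -nun (bigD1 j) //= leq_addr.
rewrite -(matrix_sum_iter _ _ nule) /matrix_sum.
under eq_bigr do rewrite omega_alternant big_distrl.
rewrite exchange_big /= [in RHS](exchange_big_dep xpredT) //= big_distrr /=.
apply: eq_bigr => m _; under eq_bigr do rewrite -mulrA -natrM.
rewrite -big_distrr -natr_sum (burnside_pair _ _ nun) /= sumr_const.
rewrite natrM -[alternant m *+ _]mulr_natr [RHS]mulrCA; congr (_ * (_ * _%:R)).
by apply: eq_card => tau; rewrite !inE.
Qed.

(** The lexicographic order, phrased in the way it is applied: at the first position where a
    comparison matters. *)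
Definition lex_le l l' :=
  forall j : 'I_N.+1, (forall i : 'I_N.+1, (i < j)%N -> l' i = l i) -> (l j <= l' j)%N.

Lemma lex_total l l' : lex_le l l' \/ lex_le l' l.
Proof.
case: (pickP (fun j : 'I_N.+1 => (l j != l' j) &&
   [forall i : 'I_N.+1, (i < j)%N ==> (l i == l' i)])) => [j /andP[ne /forallP h] | none].
  have key (a b : T) : (a j < b j)%N -> (forall i : 'I_N.+1, (i < j)%N -> a i = b i) -> lex_le a b.
    move=> ab eqab k eqk; case: (ltngtP k j) => [kj | jk | /val_inj -> //].
    - by rewrite eqab.
    - by move: ab; rewrite eqk // ltnn.
    - exact: ltnW.
  have h' (i : 'I_N.+1) : (i < j)%N -> l i = l' i by move=> ij; apply/eqP/(implyP (h i)).
  case: (ltngtP (l j) (l' j)) => [lt | lt | /val_inj e].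
  - by left; apply: key.
  - by right; apply: key => // i /h' ->.
  - by rewrite e eqxx in ne.
left=> j _; suff: forall d (i : 'I_N.+1), (i < d)%N -> l i = l' i.
  by move=> /(_ j.+1 j (ltnSn _)) ->.
elim=> // d IH i id; apply/eqP.
move: (none i) => /negbT; rewrite negb_and negbK => /orP[// | /forallPn[k]].
by rewrite negb_imply => /andP[ki]; rewrite IH ?eqxx //; apply: leq_trans ki id.
Qed.

Lemma part_ord l (i : 'I_N.+1) : part l i = (l i - (N - i))%N.
Proof. by rewrite /part valK. Qed.

(** The Jacobi-Trudi expansion: an alternating sum of Young permutation characters. A permutation w
    with a negative entry in l - w delta counts no function and drops out. *)
Lemma omega_nb_fixedE l s : omega l s =
  \sum_(w : 'S_N.+1 | [forall i, staircase (w i) <= l i]%N)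
     (-1) ^+ odd_perm w * (nb_fixed (fun i => l i - staircase (w i))%N s)%:R.
Proof.
rewrite [RHS]big_mkcond; apply: eq_bigr => w _; case: ifP => okw.
  congr (_ * _%:R); apply: eq_card => f; rewrite !inE; congr (_ && _).
  apply: eq_forallb => i; rewrite -{1}(subnKC (forallP okw i)).
  by rewrite eqn_add2l.
rewrite (_ : #|_| = 0%N) ?mulr0 //; apply: eq_card0 => f; rewrite !inE.
apply/negP => /andP[_ /forallP e]; move/negP: okw; apply.
by apply/forallP=> i; rewrite -(eqP (e i)) leq_addr.
Qed.

(** Expanding [omega l'] by Jacobi-Trudi leaves coefficients of x^l in a_delta h_nu with nu = l' - w
    delta. By triangularity these vanish except for w = 1 and l = l'. *)
Lemma omega_orthonormal_lex l l' :
    strictly_decreasing l -> strictly_decreasing l' ->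
    weight l' = (weight staircase + n)%N -> lex_le l l' ->
  \sum_s omega l s * omega l' s = n`!%:R * (l == l')%:R.
Proof.
move=> ld ld' wl lex.
pose ok w := [forall i, staircase (w i) <= l' i]%N.
pose nu w i := (l' i - staircase (w i))%N.
have nuS w : ok w -> (\sum_i nu w i = n)%N.
  move=> /forallP okw; apply/(@addnI (weight staircase)).
  rewrite -wl -(weight_perm _ w) /weight -big_split /=.
  by apply: eq_bigr => i _; rewrite ffunE subnKC.
under eq_bigr do rewrite (omega_nb_fixedE l') big_distrr.
rewrite exchange_big /=.
transitivity (\sum_(w | ok w) (n`!%:R * ((-1) ^+ odd_perm w *
    iter_pieri [seq nu w j | j <- enum 'I_N.+1] alternant l))).
  apply: eq_bigr => w okw; rewrite mulrCA -(omega_nb_fixed l (nuS w okw)) big_distrr.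
  by apply: eq_bigr => s _; rewrite mulrCA.
have size_nu w : size [seq nu w j | j <- enum 'I_N.+1] = N.+1.
  by rewrite size_map size_enum_ord.
have nth_nu w (i : 'I_N.+1) : nth 0%N [seq nu w j | j <- enum 'I_N.+1] i = nu w i.
  by rewrite (nth_map ord0) ?size_enum_ord // nth_ord_enum.
have van w : ok w -> (w != 1%g) || (l != l') ->
    iter_pieri [seq nu w j | j <- enum 'I_N.+1] alternant l = 0.
  move=> /forallP okw ne.
  (* At the first bad j one has j <= w j and l j <= l' j, at least one of them strict, so that nu w
     j = l' j - (N - w j) exceeds the part l j - (N - j). *)
  pose bad (j : 'I_N.+1) := (w j != j) || (l' j != l j).
  have [j0 bad0] : exists j, bad j.
    apply/existsP; apply: contraLR ne; rewrite negb_exists negb_or !negbK => /forallP h.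
    apply/andP; split; apply/eqP.
      by apply/permP=> j; rewrite perm1; apply/eqP; have := h j; rewrite negb_or !negbK => /andP[].
    by apply/ffunP=> j; apply/esym/eqP; have := h j; rewrite negb_or !negbK => /andP[].
  case: (arg_minnP (fun j : 'I_N.+1 => j : nat) bad0) => j badj minj.
  have good (i : 'I_N.+1) : (i < j)%N -> w i = i /\ l' i = l i.
    move=> ij; have : ~~ bad i by apply: contraL ij => /minj; rewrite -leqNgt.
    by rewrite negb_or !negbK => /andP[/eqP ? /eqP ?].
  have wj : (j <= w j)%N.
    rewrite leqNgt; apply/negP => wj; have [e _] := good _ wj.
    by move: wj; rewrite (perm_inj e) ltnn.
  have lj : (l j <= l' j)%N by apply: lex => i /good[].
  apply: (@iter_pieri_lex _ _ _ _ _ j) => //.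
  - exact: antisymmetric_alternant.
  - by rewrite size_nu.
  - move=> i ij; have iN : (i < N.+1)%N by apply: ltn_trans ij _.
    have [wi li] := good (Ordinal iN) ij.
    by rewrite -[i]/(val (Ordinal iN)) nth_nu part_ord /nu wi li staircaseE.
  rewrite nth_nu part_ord /nu; have := okw j; rewrite !staircaseE => okj.
  have := sdec_ge ld j; rewrite /= => lNj.
  move: lj; case: (ltngtP (l j) (l' j)) => // [lt _ | /val_inj e _].
    by have := ltn_ord j; lia.
  have : w j != j by move: badj; rewrite /bad e eqxx orbF.
  by rewrite -val_eqE /= => nwj; have := ltn_ord (w j); rewrite -e in okj *; lia.
rewrite -big_distrr /=; congr (_ * _).
case: eqP => [ll | /eqP nll]; last first.
  by rewrite big1 // => w okw; rewrite van ?mulr0 // nll orbT.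
have ok1 : ok 1%g.
  apply/forallP=> i; rewrite perm1 staircaseE.
  exact: (sdec_ge ld').
rewrite (bigD1 1%g) //= big1 ?addr0 => [|w /andP[okw nw]]; last first.
  by rewrite van ?mulr0 // nw.
rewrite odd_perm1 expr0 mul1r -alternant_staircase; apply: iter_pieri_eq => //.
- exact: antisymmetric_alternant.
- exact: staircaseE.
move=> i; case: (ltnP i N.+1) => iN.
  by rewrite -[i]/(val (Ordinal iN)) nth_nu part_ord /nu perm1 staircaseE ll.
by rewrite nth_default ?size_nu // /part insubF // ltnNge iN.
Qed.

Lemma omega_orthonormal l l' :
    strictly_decreasing l -> strictly_decreasing l' ->
    weight l = (weight staircase + n)%N -> weight l' = (weight staircase + n)%N ->
  \sum_s omega l s * omega l' s = n`!%:R * (l == l')%:R.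
Proof.
move=> ld ld' wl wl'; have [lex | lex] := lex_total l l'.
  exact: omega_orthonormal_lex.
by under eq_bigr do rewrite mulrC; rewrite omega_orthonormal_lex // eq_sym.
Qed.

End Omega.

(** * The bialternant formula *)

Lemma sort_strictly_decreasing (N L : nat) (m : {ffun 'I_N.+1 -> 'I_L.+1}) :
  injective m -> exists v : 'S_N.+1, strictly_decreasing (fperm m v).
Proof.
move=> m_inj; pose r := [rel i j : 'I_N.+1 | m j <= m i]%N.
pose s := sort r (enum 'I_N.+1).
have r_total : total r by move=> i j; apply: leq_total.
have r_trans : transitive r by move=> i j k /= h1 h2; apply: leq_trans h2 h1.
have ss : size s = N.+1 by rewrite size_sort size_enum_ord.
have s_uniq : uniq s by rewrite sort_uniq enum_uniq.
have v_inj : injective (fun i : 'I_N.+1 => nth ord0 s i).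
  move=> i j /= /eqP; rewrite nth_uniq ?ss // => /eqP; exact: val_inj.
exists (perm v_inj) => i j ij; rewrite !ffunE !permE ltn_neqAle; apply/andP; split.
  apply/negP => /eqP/val_inj/m_inj/v_inj e.
  by rewrite e ltnn in ij.
by apply: (sorted_ltn_nth r_trans ord0 (sort_sorted r_total _)) ij; rewrite inE ss.
Qed.

Section Bialternant.
Variables (n N L : nat).
Hypothesis le_NnL : (N + n <= L)%N.
Local Notation T := {ffun 'I_N.+1 -> 'I_L.+1}.
Implicit Types (l m : T) (s : 'S_n) (w : 'S_N.+1).
Local Notation delta := (staircase N L).

(** The power sum p_s is symmetric: renaming the values of f by v permutes its type and keeps it
    fixed by s. The sign comes from a_delta. *)
Lemma omega_perm l v s : omega (fperm l v) s = (-1) ^+ odd_perm v * omega l s.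
Proof.
rewrite /omega (reindex_inj (mulgI v)) big_distrr; apply: eq_bigr => w _ /=.
rewrite odd_permM signr_addb mulrA; congr (_ * _%:R).
pose phi (f : {ffun 'I_n -> 'I_N.+1}) := [ffun k => v (f k)].
have phi_inj : injective phi.
  by move=> f g /ffunP e; apply/ffunP=> k; have := e k; rewrite !ffunE => /perm_inj.
have phi_type f i : ftype (phi f) (v i) = ftype f i.
  by apply: eq_card => k; rewrite !inE ffunE (inj_eq perm_inj).
have phi_fix f : (fperm (phi f) s == phi f) = (fperm f s == f).
  rewrite -[RHS](inj_eq phi_inj); congr (_ == _).
  by apply/ffunP=> k; rewrite !ffunE.
rewrite -(card_imset _ phi_inj); apply: eq_card => g.
apply/imsetP/idP => [[f] | ].
  rewrite !inE => /andP[ff /forallP tf] ->; rewrite phi_fix ff; apply/forallP=> i.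
  have := tf (v^-1 i)%g; rewrite [fperm _ _ _]ffunE -phi_type.
  by rewrite permM !permKV.
rewrite inE => gP; have gE : g = phi [ffun k => (v^-1 (g k))%g].
  by apply/ffunP=> k; rewrite !ffunE permKV.
exists [ffun k => (v^-1 (g k))%g] => //.
move: gP; rewrite {1 2 3}gE phi_fix inE => /andP[-> /forallP tf].
apply/forallP=> i; have := tf (v i); rewrite phi_type.
by rewrite permM [fperm _ _ _]ffunE.
Qed.

Lemma omega_eq0 l i j s : i != j -> l i = l j -> omega l s = 0.
Proof.
move=> ij lij; have := omega_perm l (tperm i j) s.
have -> : fperm l (tperm i j) = l.
  by apply/ffunP=> k; rewrite ffunE; case: tpermP => [-> | -> | ].
by rewrite odd_tperm ij mulN1r => /esym/eqP; rewrite eqNr => /eqP.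
Qed.

Lemma omega_weight l s : weight l != (weight delta + n)%N -> omega l s = 0.
Proof.
move=> wl; apply: big1 => w _; rewrite (_ : #|_| = 0%N) ?mulr0 //.
apply: eq_card0 => f; rewrite !inE; apply/negP => /andP[_ /forallP e].
case/eqP: wl; rewrite -(weight_perm delta w) -[X in (_ + X)%N](sum_ftype f) /weight -big_split.
by apply: eq_bigr => i _; rewrite -(eqP (e i)) [fperm _ _ _]ffunE.
Qed.

Lemma sdec_inj l : strictly_decreasing l -> injective (fperm l).
Proof.
move=> ld v w /ffunP e; apply/permP=> i; apply: val_inj.
have := e i; rewrite !ffunE; case: (ltngtP (v i) (w i)) => // /ld lt ee.
  by rewrite ee ltnn in lt.
by rewrite ee ltnn in lt.
Qed.

(** Orthonormality for an arbitrary exponent m: a repeated entry or a wrong weight makes [omega m]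
    zero, and otherwise sorting m costs a sign. *)
Lemma omega_dot l m :
    strictly_decreasing l -> weight l = (weight delta + n)%N ->
  \sum_(s : 'S_n) omega l s * omega m s =
  n`!%:R * \sum_v (-1) ^+ odd_perm v * (m == fperm l v)%:R.
Proof.
move=> ld wl.
case: (pickP (fun v => m == fperm l v)) => [v /eqP -> | none].
  rewrite (bigD1 v) //= eqxx [X in _ + X]big1 => [|w nw]; last first.
    by rewrite (inj_eq (sdec_inj ld)) eq_sym (negPf nw) mulr0.
  under eq_bigr do rewrite omega_perm mulrCA.
  by rewrite -big_distrr /= omega_orthonormal // eqxx !mulr1 addr0 mulrC.
rewrite [X in _ = _ * X]big1 ?mulr0 => [|v _]; last by rewrite none mulr0.
have [m_inj | ] := boolP (injectiveb m); last first.
  move=> /injectivePn[i [j ij mij]]; apply: big1 => s _.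
  by rewrite (omega_eq0 _ ij mij) mulr0.
have [wm | wm] := eqVneq (weight m) (weight delta + n)%N; last first.
  by apply: big1 => s _; rewrite (omega_weight _ wm) mulr0.
have [v dv] := sort_strictly_decreasing (injectiveP _ m_inj).
have mE s : omega m s = (-1) ^+ odd_perm v * omega (fperm m v) s.
  by rewrite omega_perm mulrA -signr_addb addbb mul1r.
under eq_bigr do rewrite mE mulrCA.
rewrite -big_distrr /= omega_orthonormal ?weight_perm //.
case: (l =P fperm m v) => [e | _]; last by rewrite !mulr0.
by have := none (v^-1)%g; rewrite e -fpermM mulVg fperm1 eqxx.
Qed.

Variables (K : fieldType) (emb : {rmorphism algC -> K}) (x : 'I_N.+1 -> K).

(** The power sum p_s(x) of the cycle type of s, expanded into monomials; [power_fixed_porbits]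
    gives the product over cycles. *)
Definition power_fixed s : K :=
  \sum_(f : {ffun 'I_n -> 'I_N.+1} | fperm f s == f) \prod_k x (f k).

Lemma prod_ftype (f : {ffun 'I_n -> 'I_N.+1}) :
  \prod_k x (f k) = \prod_i x i ^+ ftype f i.
Proof.
rewrite (partition_big f xpredT) //=; apply: eq_bigr => i _.
rewrite (eq_bigr (fun=> x i)) => [|k /eqP -> //].
by rewrite prodr_const; congr (_ ^+ _); apply: eq_card => k; rewrite !inE.
Qed.

Lemma alternant_power_fixed s :
  \det (\matrix_(i, j) x i ^+ delta j) * power_fixed s =
  \sum_(m : T) emb (omega m s) * \prod_i x i ^+ m i.
Proof.
transitivity (\sum_w \sum_(f : {ffun 'I_n -> 'I_N.+1} | fperm f s == f)
  ((-1) ^+ odd_perm w * \prod_i x i ^+ (delta (w i) + ftype f i))).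
  rewrite /determinant big_distrl; apply: eq_bigr => w _ /=.
  rewrite -mulrA big_distrr big_distrr; apply: eq_bigr => f _ /=.
  congr (_ * _); rewrite prod_ftype -big_split; apply: eq_bigr => i _ /=.
  by rewrite mxE exprD.
under [RHS]eq_bigr do rewrite rmorph_sum /= big_distrl.
rewrite [RHS]exchange_big /=; apply: eq_bigr => w _.
pose ty (f : {ffun 'I_n -> 'I_N.+1}) : T := [ffun i => inord (delta (w i) + ftype f i)].
have tyE f i : ty f i = (delta (w i) + ftype f i)%N :> nat.
  rewrite ffunE inordK // ltnS; apply: leq_trans le_NnL; apply: leq_add.
    by rewrite (staircaseE le_NnL) leq_subr.
  by apply: leq_trans (max_card _) _; rewrite card_ord.
rewrite (partition_big ty xpredT) //=; apply: eq_bigr => m _.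
rewrite rmorphM rmorph_sign rmorph_nat -mulrA mulr_natl -sumr_const.
rewrite big_distrr /=; apply: eq_big => [f | f /andP[_ /eqP <-]].
  rewrite inE; congr (_ && _); apply/eqP/forallP => [<- i | e].
    by rewrite tyE.
  by apply/ffunP=> i; apply: val_inj; rewrite /= tyE (eqP (e i)).
by congr (_ * _); apply: eq_bigr => i _; rewrite tyE.
Qed.

(** Pairing the expansion of a_delta p_s with [omega l] keeps only the exponents that are
    rearrangements of l, with their signs: the Leibniz expansion of the right-hand determinant.
    Keeping a_delta as a factor avoids asking that it be nonzero. *)
Lemma omega_bialternant l :
    strictly_decreasing l -> weight l = (weight delta + n)%N ->
  \det (\matrix_(i, j) x i ^+ delta j) * (\sum_(s : 'S_n) emb (omega l s) * power_fixed s) =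
  n`!%:R * \det (\matrix_(i, j) x i ^+ l j).
Proof.
move=> ld wl; rewrite big_distrr /=.
under eq_bigr do rewrite mulrCA alternant_power_fixed big_distrr /=.
rewrite exchange_big /=.
transitivity (\sum_(m : T) emb (\sum_(s : 'S_n) omega l s * omega m s) * \prod_i x i ^+ m i).
  apply: eq_bigr => m _; rewrite rmorph_sum big_distrl; apply: eq_bigr => s _ /=.
  by rewrite rmorphM mulrA.
under eq_bigr do rewrite omega_dot // rmorphM rmorph_nat -mulrA rmorph_sum big_distrl.
rewrite -big_distrr exchange_big /=; congr (_ * _); apply: eq_bigr => w _.
rewrite (bigD1 (fperm l w)) //= eqxx mulr1 rmorph_sign [X in _ + X]big1 ?addr0 => [|m /negPf ->].
  by congr (_ * _); apply: eq_bigr => i _; rewrite mxE [fperm _ _ _]ffunE.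
by rewrite mulr0 rmorph0 mul0r.
Qed.

End Bialternant.

(** * Column-injective fillings of a Young diagram *)

Section Tableau.
Variables (n : nat) (la : seq nat).
Hypothesis hla : is_partition n la.
Local Notation row k := (reshape_index la k).
Local Notation col k := (reshape_offset la k).
Implicit Types (k : 'I_n) (s : 'S_n).

Lemma sumn_partition : sumn la = n.
Proof. by have /and3P[_ _ /eqP] := hla. Qed.

Lemma nth_partition_le i j : (i <= j)%N -> (nth 0 la j <= nth 0 la i)%N.
Proof.
move=> ij; have /and3P[la_sorted _ _] := hla.
case: (ltnP j (size la)) => [jla | ?]; last by rewrite nth_default.
apply: (sorted_leq_nth _ _ 0%N la_sorted) => //.
- by move=> a b c /= h1 h2; apply: leq_trans h2 h1.
- by move=> a /=.
- by rewrite inE (leq_ltn_trans ij).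
Qed.

Lemma col_lt k : (col k < nth 0 la (row k))%N.
Proof. by apply: reshape_offsetP; rewrite sumn_partition. Qed.

Lemma box_inj k k' : row k = row k' -> col k = col k' -> k = k'.
Proof.
move=> er ec; apply: val_inj => /=.
by rewrite -(reshape_indexK la k) -(reshape_indexK la k') er ec.
Qed.

Lemma box_ex i j : (j < nth 0 la i)%N -> exists k, row k = i /\ col k = j.
Proof.
move=> ji; have lt_n : (flatten_index la i j < n)%N.
  by rewrite -sumn_partition flatten_indexP.
by exists (Ordinal lt_n); rewrite flatten_indexKl ?flatten_indexKr.
Qed.

Lemma box_above k i : (i <= row k)%N -> exists k', row k' = i /\ col k' = col k.
Proof.
move=> ik; apply: box_ex; apply: leq_trans (col_lt k) _.
exact: nth_partition_le.
Qed.

Definition col_injective (f : 'I_n -> nat) :=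
  forall k k', col k = col k' -> f k = f k' -> k = k'.

Lemma nth_partition_le_n i : (nth 0 la i <= n)%N.
Proof.
rewrite -[leqRHS]sumn_partition sumnE.
case: (ltnP i (size la)) => [lt | ?]; last by rewrite nth_default.
by rewrite (big_nth 0%N) big_mkord (bigD1 (Ordinal lt)) //= leq_addr.
Qed.

Lemma col_le k : (col k <= n)%N.
Proof. exact: leq_trans (ltnW (col_lt k)) (nth_partition_le_n _). Qed.

Lemma card_by_col (P : pred 'I_n) :
  #|[set k | P k]| = (\sum_(c < n.+1) #|[set k | P k & col k == c]|)%N.
Proof.
rewrite -sum1dep_card (partition_big (fun k => inord (col k) : 'I_n.+1) xpredT) //=.
apply: eq_bigr => c _; rewrite sum1dep_card; apply: eq_card => k.
by rewrite !inE -val_eqE /= inordK // ltnS col_le.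
Qed.

(** If column c reaches row j, send k to the box of its column in row f k, which is injective.
    Otherwise the whole column lies in the first j rows. *)
Lemma col_injective_card_col f j c : col_injective f ->
  (#|[set k : 'I_n | (f k < j)%N & col k == c]| <= #|[set k : 'I_n | (row k < j)%N & col k == c]|)%N.
Proof.
move=> f_inj; set A := [set k | _ & _]; set B := [set k | _ & _].
case: (pickP [pred k : 'I_n | (j <= row k)%N && (col k == c)]) => [k0 /andP[jk /eqP kc] | none].
  pose phi k := odflt k [pick k' : 'I_n | (row k' == f k) && (col k' == col k)].
  have phiP k : k \in A -> row (phi k) = f k /\ col (phi k) = col k.
    rewrite inE => /andP[fk /eqP ck]; rewrite /phi; case: pickP => [k' /andP[/eqP ? /eqP ?] //|].
    have [|k' [r1 r2] /(_ k')] := @box_above k0 (f k).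
      exact: leq_trans (ltnW fk) jk.
    by rewrite r1 r2 kc ck !eqxx.
  rewrite -(card_in_imset (f := phi) (D := A)).
    apply/subset_leq_card/subsetP=> _ /imsetP[k kA ->].
    by have [r1 r2] := phiP k kA; rewrite inE r1 r2; rewrite inE in kA.
  move=> k k' kA kA' e; have [r1 r2] := phiP k kA; have [r1' r2'] := phiP k' kA'.
  by apply: f_inj; rewrite -?r2 -?r1 e.
apply/subset_leq_card/subsetP=> k; rewrite !inE => /andP[_ kc].
by rewrite kc andbT ltnNge; have := none k; rewrite inE kc andbT => ->.
Qed.

Lemma col_injective_card f j : col_injective f ->
  (#|[set k : 'I_n | (f k < j)%N]| <= #|[set k : 'I_n | (row k < j)%N]|)%N.
Proof.
move=> f_inj; rewrite !card_by_col; apply: leq_sum => c _.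
exact: col_injective_card_col.
Qed.

(** The permutation c moves k within its column to row f k. Were there no such box, the whole column
    of k would lie above row f k while k itself is not counted by f < f k; the inequality of
    [col_injective_card_col] would be strict there, against the equality of totals. *)
Lemma col_injective_row f : col_injective f ->
    (forall i, #|[set k : 'I_n | f k == i]| = #|[set k : 'I_n | row k == i]|) ->
  exists2 c : 'S_n, c \in col_stab n la & forall k, f k = row (c k).
Proof.
move=> f_inj tf.
have cardE j : #|[set k : 'I_n | (f k < j)%N]| = #|[set k : 'I_n | (row k < j)%N]|.
  elim: j => [|j IH]; first by apply: eq_card => k; rewrite !inE.
  have step (g : 'I_n -> nat) : #|[set k : 'I_n | (g k < j.+1)%N]| =
      (#|[set k : 'I_n | (g k < j)%N]| + #|[set k | g k == j]|)%N.
    rewrite -cardsUI [X in (_ = _ + X)%N](_ : _ = 0)%N ?addn0; last first.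
      by apply: eq_card0 => k; rewrite !inE; case: ltngtP.
    by apply: eq_card => k; rewrite !inE ltnS leq_eqVlt orbC.
  by rewrite !step IH tf.
have ex k : exists k' : 'I_n, (row k' == f k) && (col k' == col k).
  case: (pickP [pred k' : 'I_n | (row k' == f k) && (col k' == col k)]) => [k' ? | none].
    by exists k'.
  have all_lt k' : col k' = col k -> (row k' < f k)%N.
    move=> ek; rewrite ltnNge; apply/negP => /box_above[k'' [r1 r2]].
    by have := none k''; rewrite /= r1 r2 ek !eqxx.
  exfalso; have := cardE (f k); rewrite !card_by_col.
  have ck : (col k < n.+1)%N by rewrite ltnS col_le.
  rewrite (bigD1 (Ordinal ck)) //= [RHS](bigD1 (Ordinal ck)) //=.
  apply/eqP; rewrite ltn_eqF // -addSn leq_add //; last first.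
    by apply: leq_sum => c _; apply: col_injective_card_col.
  apply: proper_card; apply/properP; split.
    apply/subsetP=> k'; rewrite !inE => /andP[_ /eqP e].
    by rewrite e eqxx all_lt.
  by exists k; rewrite !inE ?ltnn // eqxx all_lt.
pose phi k := xchoose (ex k).
have phiP k : row (phi k) = f k /\ col (phi k) = col k.
  by have /andP[/eqP ? /eqP ?] := xchooseP (ex k).
have phi_inj : injective phi.
  move=> k k' e; apply: f_inj.
    by have [_ <-] := phiP k; have [_ <-] := phiP k'; rewrite e.
  by have [<- _] := phiP k; have [<- _] := phiP k'; rewrite e.
exists (perm phi_inj); last by move=> k; rewrite permE; have [->] := phiP k.
by rewrite inE; apply/forallP=> k; rewrite permE; have [_ ->] := phiP k.
Qed.

Lemma card_row i : #|[set k : 'I_n | row k == i]| = nth 0%N la i.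
Proof.
rewrite -[RHS]card_ord.
(* The successor keeps the target nonempty, as [inord] requires, even if row i is empty. *)
pose g k : 'I_(nth 0%N la i).+1 := inord (col k).
have colE k : k \in [set k : 'I_n | row k == i] -> g k = col k :> nat.
  rewrite inE => /eqP e; rewrite inordK // ltnS -e; exact: ltnW (col_lt k).
rewrite -(card_in_imset (f := g)) => [|k k' kA kA' e]; last first.
  apply: box_inj; first by move: kA kA'; rewrite !inE => /eqP -> /eqP ->.
  by rewrite -colE // -colE // e.
have w_inj : injective (widen_ord (leqnSn (nth 0%N la i))).
  by move=> a b [e]; apply: val_inj.
rewrite -(card_imset _ w_inj).
apply: eq_card => j; apply/imsetP/imsetP => [[k kA ->] | [j' _ ->]].
  have lt : (col k < nth 0 la i)%N.
    by move: (kA); rewrite inE => /eqP <-; exact: col_lt.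
  by exists (Ordinal lt) => //; apply: val_inj; rewrite /= colE.
have [k [r1 r2]] := @box_ex i j' (ltn_ord j').
have kA : k \in [set k : 'I_n | row k == i] by rewrite inE r1.
by exists k => //; apply: val_inj; rewrite /= colE // r2.
Qed.

End Tableau.

(** * The character of a Specht module *)

Section CyclicCharacter.
Variables (F : fieldType) (gT : finGroupType) (G : {group gT}).
Local Notation aG := (regular_repr F G).
Variables (kap : gT -> F) (k : F) (C : 'M[F]_(gcard G)).
Hypothesis defC : C = \sum_(x in G) kap x *: aG x.
Hypothesis CC : C *m C = k *: C.
Local Notation v := (gring_row C).

Lemma gring_row_repr y : y \in G -> gring_row (aG y) = delta_mx 0 (gring_index G y).
Proof. by move=> Gy; rewrite /gring_row rowK gring_indexK ?group1 // mul1g. Qed.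

(* The row space of [L = \matrix_i (v *m aG h_i)], which is left multiplication
   by C on the group algebra, is the module generated by v, and L / k projects
   onto it. *)
Lemma cyclic_module_trace g : g \in G ->
  k * \tr (submod_repr (cyclic_mx_module aG v) g) =
  \sum_(h in G) kap (h * g^-1 * h^-1)%g.
Proof.
move=> Gg.
pose L : 'M[F]_(gcard G) := \matrix_(i < gcard G) (v *m aG (enum_val (A := G) i)).
have CG : (C \in group_ring F G)%MS.
  rewrite defC (linear_sum mxvec) summx_sub // => x Gx.
  by rewrite linearZ scalemx_sub // envelop_mx_id.
have uL (u : 'rV_(gcard G)) : u *m L = v *m gring_mx aG u.
  rewrite /gring_mx /= [LHS]mulmx_sum_row [u *m _]mulmx_sum_row linear_sum mulmx_sumr.
  by apply: eq_bigr => i _; rewrite !rowK linearZ /= mxvecK scalemxAr.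
have vC : v *m C = k *: v by rewrite -gring_row_mul CC linearZ.
have LL : L *m L = k *: L.
  apply/row_matrixP=> i; rewrite row_mul uL rowK gring_mxJ ?enum_valP //.
  by rewrite gring_rowK // mulmxA vC linearZ /= rowK scalemxAl.
pose U := cyclic_mx aG v.
have UL : (U <= L)%MS.
  apply/row_subP=> i; have [A AG ->] := cyclic_mxP (row_sub i U).
  by rewrite -[A]gring_rowK // -uL submxMl.
have LU : (L <= U)%MS.
  apply/row_subP=> i; rewrite rowK; apply/cyclic_mxP.
  by exists (aG (enum_val i)); rewrite ?envelop_mx_id ?enum_valP.
have UE m (W : 'M_(m, gcard G)) : (W <= U)%MS -> W *m L = k *: W.
  by move=> /submx_trans/(_ UL)/submxP[X ->]; rewrite -mulmxA LL scalemxAr.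
transitivity (\tr (L *m aG g)).
  pose B := val_submod (U := U) 1%:M; pose P := in_submod U (1%:M : 'M_(gcard G)).
  have -> : L *m aG g = (L *m P) *m (B *m aG g).
    by rewrite mulmxA; congr (_ *m _); rewrite -val_submodE -in_submodE in_submodK.
  rewrite [RHS]mxtrace_mulC [X in _ = \tr X]mulmxA UE; last first.
    by rewrite mxmodule_trans ?cyclic_mx_module ?val_submodP.
  by rewrite -scalemxAl mxtraceZ -in_submodE.
(* The diagonal entry at h is the coefficient of h in C h g; the only x with x h g = h is h g^-1
   h^-1. *)
rewrite /mxtrace (reindex_onto (gring_index G) enum_val) /=; last first.
  by move=> i _; rewrite gring_valK.
rewrite [RHS]big_mkcond [LHS]big_mkcond /=; apply: eq_bigr => h _.
have [Gh | nGh] := boolP (h \in G); last first.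
  case: eqP => // e; case/negP: nGh; rewrite -e; exact: enum_valP.
rewrite gring_indexK // eqxx.
have -> : (L *m aG g) (gring_index G h) (gring_index G h) =
    row (gring_index G h) (L *m aG g) 0 (gring_index G h) by rewrite [RHS]mxE.
rewrite row_mul rowK gring_indexK // -mulmxA -repr_mxM // -gring_row_mul defC.
rewrite mulmx_suml linear_sum summxE /=.
rewrite (bigD1 (h * g^-1 * h^-1)%g) /= ?groupM ?groupV // big1 ?addr0.
  rewrite -scalemxAl -repr_mxM ?groupM ?groupV // linearZ /= gring_row_repr ?groupM ?groupV //.
  by rewrite [(_ * (h * g))%g]mulgA !mulgKV !mxE !eqxx mulr1.
move=> x /andP[Gx nx].
rewrite -scalemxAl -repr_mxM ?groupM // linearZ /= gring_row_repr ?groupM //.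
rewrite !mxE /= (can_in_eq (gring_indexK (G := G))) ?groupM //.
case: eqP => [e | _]; last by rewrite mulr0.
case/eqP: nx; apply: (mulIg (h * g)%g).
by rewrite [RHS]mulgA !mulgKV.
Qed.

End CyclicCharacter.

(** * Young symmetrizers *)

Section Young.
Variables (n : nat) (la : seq nat).
Hypothesis hla : is_partition n la.
Local Notation row k := (reshape_index la k).
Local Notation col k := (reshape_offset la k).
Local Notation R := (row_stab n la).
Local Notation Q := (col_stab n la).
Local Notation rho := (regS n).
Implicit Types (k : 'I_n) (g h : 'S_n).

Lemma row_stabP g : reflect (forall k, row (g k) = row k) (g \in R).
Proof. by rewrite inE; apply: (iffP forallP) => h k; apply/eqP. Qed.

Lemma col_stabP g : reflect (forall k, col (g k) = col k) (g \in Q).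
Proof. by rewrite inE; apply: (iffP forallP) => h k; apply/eqP. Qed.

Lemma row_stab_group_set : group_set R.
Proof.
apply/group_setP; split=> [|g h /row_stabP Rg /row_stabP Rh].
  by apply/row_stabP=> k; rewrite perm1.
by apply/row_stabP=> k; rewrite permM Rh Rg.
Qed.
Canonical row_stab_group := Group row_stab_group_set.

Lemma col_stab_group_set : group_set Q.
Proof.
apply/group_setP; split=> [|g h /col_stabP Qg /col_stabP Qh].
  by apply/col_stabP=> k; rewrite perm1.
by apply/col_stabP=> k; rewrite permM Qh Qg.
Qed.
Canonical col_stab_group := Group col_stab_group_set.

Lemma row_col_stab_eq1 g : g \in R -> g \in Q -> g = 1%g.
Proof.
move=> /row_stabP Rg /col_stabP Qg; apply/permP=> k; rewrite perm1.
exact: box_inj (Rg k) (Qg k).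
Qed.

(* The coefficient of g in the Young symmetrizer. *)
Definition young_coef g : algC :=
  \sum_(r in R) \sum_(c in Q) (-1) ^+ odd_perm c * ((r * c)%g == g)%:R.

Lemma young_coef_mul r c : r \in R -> c \in Q ->
  young_coef (r * c)%g = (-1) ^+ odd_perm c.
Proof.
move=> Rr Qc; rewrite /young_coef (bigD1 r) //= (bigD1 c) //= eqxx mulr1.
rewrite big1 ?addr0 => [|c' /andP[_ nc]]; last first.
  by rewrite (inj_eq (mulgI r)) (negPf nc) mulr0.
rewrite big1 ?addr0 // => r' /andP[Rr' nr]; rewrite big1 // => c' Qc'.
case: eqP => [e | _]; last by rewrite mulr0.
have e1 : (r^-1 * r')%g = (c * c'^-1)%g.
  by apply: (mulgI r); rewrite mulKVg mulgA; apply: (mulIg c'); rewrite mulgKV.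
case/eqP: nr; apply: (mulgI r^-1%g); rewrite mulVg.
apply: row_col_stab_eq1; first by rewrite groupM ?groupV.
by rewrite e1 groupM ?groupV.
Qed.

Lemma young_coef1 : young_coef 1%g = 1.
Proof. by rewrite -[1%g]mulg1 young_coef_mul ?group1 // odd_perm1. Qed.

Lemma young_coef0 g k k' : k != k' -> row k = row k' -> col (g k) = col (g k') ->
  young_coef g = 0.
Proof.
move=> nk ek eg; apply: big1 => r /row_stabP Rr; apply: big1 => c /col_stabP Qc.
case: eqP => [e | _]; last by rewrite mulr0.
case/eqP: nk; apply: (@perm_inj _ r); apply: (@box_inj n la); first by rewrite !Rr.
by rewrite -Qc -[in RHS]Qc -!permM e.
Qed.

Definition row_sum := \sum_(r in R) rho r.
Definition signed_col_sum := \sum_(c in Q) (-1) ^+ odd_perm c *: rho c.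
Definition young_mx := row_sum *m signed_col_sum.

Lemma regSM g h : rho (g * h)%g = rho g *m rho h.
Proof. by rewrite repr_mxM ?inE. Qed.

Lemma row_sum_mul r : r \in R -> row_sum *m rho r = row_sum.
Proof.
move=> Rr; rewrite /row_sum mulmx_suml [RHS](reindex_inj (mulIg r)) /=.
by apply: eq_big => [x | x _]; rewrite ?groupMr ?regSM.
Qed.

Lemma mul_signed_col_sum c : c \in Q ->
  rho c *m signed_col_sum = (-1) ^+ odd_perm c *: signed_col_sum.
Proof.
move=> Qc; rewrite /signed_col_sum mulmx_sumr scaler_sumr.
rewrite [RHS](reindex_inj (mulgI c)) /=.
apply: eq_big => [x | x _]; first by rewrite groupMl.
by rewrite -scalemxAr -regSM odd_permM signr_addb scalerA mulrA -signr_addb addbb mul1r.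
Qed.

Lemma young_mxE : young_mx = \sum_(g in [set: 'S_n]) young_coef g *: rho g.
Proof.
rewrite /young_mx /row_sum /signed_col_sum mulmx_suml.
under [RHS]eq_bigr do rewrite scaler_suml.
rewrite [RHS]exchange_big /=; apply: eq_bigr => r _.
under [RHS]eq_bigr do rewrite scaler_suml.
rewrite [RHS]exchange_big mulmx_sumr /=; apply: eq_bigr => c _.
rewrite -scalemxAr -regSM (bigD1 (r * c)%g) ?inE //= eqxx mulr1 big1 ?addr0 // => g /andP[_ ng].
by rewrite eq_sym (negPf ng) mulr0 scale0r.
Qed.

(* Von Neumann's lemma. If [row \o g^-1] separates the boxes of each column,
   then g lies in R Q; otherwise some transposition of R is conjugated by g to
   one of Q, and both sides vanish. *)
Lemma young_sandwich g :
  row_sum *m rho g *m signed_col_sum = young_coef g *: young_mx.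
Proof.
case: (pickP [pred p : 'I_n * 'I_n |
   [&& p.1 != p.2, row p.1 == row p.2 & col (g p.1) == col (g p.2)]]) => [[k k'] | none].
  case/and3P => /= nk /eqP ek /eqP eg.
  rewrite (young_coef0 nk ek eg) scale0r; set X := _ *m _ *m _.
  suff XN : X = - X.
    apply/matrixP=> i j; rewrite [RHS]mxE; apply/eqP; rewrite -eqNr.
    by rewrite [in X in _ == X]XN [X in _ == X]mxE.
  have Rt : tperm k k' \in R.
    by apply/row_stabP=> x; case: tpermP => // ->.
  have Qt : (tperm k k' ^ g)%g \in Q.
    by rewrite tpermJ; apply/col_stabP=> x; case: tpermP => // ->.
  rewrite {1}/X -(row_sum_mul Rt) -(mulmxA row_sum) -regSM conjgC regSM mulmxA.
  rewrite -(mulmxA _ (rho (tperm k k' ^ g)%g)) (mul_signed_col_sum Qt).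
  by rewrite odd_permJ odd_tperm nk expr1 scaleN1r mulmxN.
pose f k := row (g^-1 k)%g.
have f_inj : col_injective la f.
  move=> k k' ek ef; apply/eqP; rewrite -(inj_eq (@perm_inj _ g^-1%g)); apply/negPn/negP=> nk.
  by have := none ((g^-1 k)%g, (g^-1 k')%g); rewrite /= nk -/(f k) -/(f k') ef !permKV ek !eqxx.
have ft i : #|[set k | f k == i]| = #|[set k : 'I_n | row k == i]|.
  rewrite -[RHS](card_preimset _ (@perm_inj _ g^-1%g)).
  by apply: eq_card => k; rewrite !inE.
have [c Qc fc] := col_injective_row hla f_inj ft.
have Rr : (g * c)%g \in R.
  by apply/row_stabP=> k; rewrite permM -fc /f permK.
have -> : g = ((g * c) * c^-1)%g by rewrite mulgK.
rewrite young_coef_mul ?groupV // regSM mulmxA row_sum_mul // -mulmxA.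
by rewrite mul_signed_col_sum ?groupV // scalemxAr.
Qed.

Definition young_sandwich_coef h : algC :=
  \sum_(c in Q) \sum_(r in R) (-1) ^+ odd_perm c * young_coef (c * h * r)%g.

Definition young_const := young_sandwich_coef 1%g.

(** Expand the inner factors (column sum, h, row sum) into group elements and apply [young_sandwich]
    to each. *)
Lemma young_mx_sandwich h :
  young_mx *m rho h *m young_mx = young_sandwich_coef h *: young_mx.
Proof.
have mid : signed_col_sum *m rho h *m row_sum =
    \sum_(c in Q) \sum_(r in R) (-1) ^+ odd_perm c *: rho (c * h * r)%g.
  rewrite /signed_col_sum !mulmx_suml; apply: eq_bigr => c _.
  rewrite /row_sum mulmx_sumr; apply: eq_bigr => r _.
  by rewrite -!scalemxAl !regSM.
have -> : young_mx *m rho h *m young_mx =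
    row_sum *m (signed_col_sum *m rho h *m row_sum) *m signed_col_sum.
  by rewrite /young_mx !mulmxA.
rewrite mid [row_sum *m _]mulmx_sumr [_ *m signed_col_sum]mulmx_suml scaler_suml; apply: eq_bigr => c _.
rewrite [row_sum *m _]mulmx_sumr [_ *m signed_col_sum]mulmx_suml scaler_suml; apply: eq_bigr => r _.
by rewrite -scalemxAr -scalemxAl young_sandwich scalerA.
Qed.

Lemma young_mx_sqr : young_mx *m young_mx = young_const *: young_mx.
Proof. by rewrite -young_mx_sandwich repr_mx1 mulmx1. Qed.

Definition specht_char g : algC := \tr (specht_repr n la g).

Lemma specht_charE g :
  young_const * specht_char g = \sum_h young_coef (h * g^-1 * h^-1)%g.
Proof.
have ysE : young_symmetrizer n la = gring_row young_mx.
  rewrite /young_symmetrizer /young_mx /row_sum /signed_col_sum mulmx_suml.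
  congr gring_row; apply: eq_bigr => r _; rewrite mulmx_sumr.
  by apply: eq_bigr => c _; rewrite -scalemxAr regSM.
rewrite /specht_char /specht_repr ysE.
rewrite (cyclic_module_trace young_mxE young_mx_sqr) ?inE //.
by apply: eq_bigl => h; rewrite inE.
Qed.

(** At g = 1, [specht_charE] reads: [young_const] times the dimension of the Specht module is n!. *)
Lemma young_const_neq0 : young_const != 0.
Proof.
apply/eqP=> k0; have := specht_charE 1%g; rewrite k0 mul0r.
under eq_bigr do rewrite invg1 mulg1 mulgV young_coef1.
rewrite sumr_const card_Sn => /esym/eqP; rewrite pnatr_eq0.
by case: _`! (fact_gt0 n).
Qed.

(** A class function does not see the conjugation by h in [specht_charE], so pairing with the
    character amounts to evaluating [phi] on the Young symmetrizer. *)
Lemma specht_char_dot (phi : 'S_n -> algC) :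
    (forall g h, phi (g ^ h)%g = phi g) ->
  young_const * (\sum_g specht_char g * phi g) =
  n`!%:R * \sum_g young_coef g * phi g^-1%g.
Proof.
move=> phiJ; rewrite big_distrr /=.
under eq_bigr do rewrite mulrA specht_charE big_distrl /=.
rewrite exchange_big /= -card_Sn -sumr_const big_distrl /=.
apply: eq_big => [h | h _]; first by rewrite inE.
rewrite mul1r (reindex_inj invg_inj) (reindex_inj (@conjg_inj _ h)) /=.
apply: eq_bigr => g _; rewrite -!conjVg phiJ invgK; congr (young_coef _ * _).
by rewrite conjgE !mulgA mulgV mul1g mulgK.
Qed.

Lemma specht_charJ g h : specht_char (g ^ h)%g = specht_char g.
Proof.
rewrite /specht_char conjgE repr_mxM ?inE // mxtrace_mulC -repr_mxM ?inE //.
by rewrite -mulgA mulgV mulg1.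
Qed.

(** Irreducibility by computation: applying [specht_char_dot] and then [specht_charE] reduces the
    norm to the coefficient of 1 in y^3, for y the Young symmetrizer, and y^3 = young_const^2 y. *)
Lemma specht_char_norm : \sum_g specht_char g * specht_char g^-1%g = n`!%:R.
Proof.
have k0 := young_const_neq0.
have yE : young_mx = \sum_g young_coef g *: rho g.
  by rewrite young_mxE; apply: eq_bigl => g; rewrite inE.
pose co x (A : 'M[algC]_(gcard [set: 'S_n])) := @gring_proj algC _ [set: 'S_n]%G x A 0 0.
have coZ x a A : co x (a *: A) = a * co x A by rewrite /co linearZ mxE.
have coE (u : 'S_n -> algC) x : co x (\sum_g u g *: rho g) = u x.
  rewrite /co linear_sum summxE (bigD1 x) //= linearZ /= gring_projE ?inE // eqxx !mxE mulr1.
  rewrite big1 ?addr0 // => g ng.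
  by rewrite linearZ /= gring_projE ?inE // eq_sym (negPf ng) scaler0 mxE.
(* The left-hand side is the coefficient of h in y h y. *)
have sw h : \sum_g young_coef g * young_coef (h * g^-1 * h^-1)%g =
    young_coef h * young_sandwich_coef h.
  have -> : young_coef h = co h young_mx by rewrite yE coE.
  rewrite mulrC -coZ -young_mx_sandwich [X in _ *m X]yE mulmx_sumr.
  rewrite -[LHS](coE (fun z => \sum_g young_coef g * young_coef (z * g^-1 * h^-1)%g)).
  congr (co h _); under eq_bigr do rewrite scaler_suml.
  rewrite exchange_big; apply: eq_bigr => y _ /=.
  rewrite -scalemxAr -mulmxA -regSM yE mulmx_suml scaler_sumr.
  rewrite [RHS](reindex_inj (mulIg (h * y)^-1%g)) /=; apply: eq_bigr => z _.
  by rewrite -scalemxAl -regSM mulgKV scalerA invMg mulgA.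
apply: (mulfI k0); rewrite specht_char_dot => [|g h]; last by rewrite -conjVg specht_charJ.
apply: (mulfI k0); rewrite mulrCA [RHS]mulrA -expr2 [RHS]mulrC; congr (_ * _).
rewrite big_distrr /=; under eq_bigr do rewrite invgK mulrCA specht_charE big_distrr /=.
rewrite exchange_big /=; under eq_bigr do rewrite sw.
have -> : young_const ^+ 2 = co 1%g (young_const *: (young_const *: young_mx)).
  by rewrite !coZ yE coE young_coef1 mulr1.
rewrite -young_mx_sqr scalemxAl -young_mx_sqr {2}yE mulmx_sumr mulmx_suml.
rewrite -[LHS]mulr1 -young_coef1 -(coE young_coef) -yE -coZ; congr (co _ _).
rewrite scaler_suml; apply: eq_bigr => h _.
by rewrite -scalemxAr -scalemxAl young_mx_sandwich scalerA.
Qed.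

End Young.

Lemma nb_fixedJ (n : nat) (I : finType) (nu : I -> nat) (g h : 'S_n) :
  nb_fixed nu (g ^ h)%g = nb_fixed nu g.
Proof.
rewrite /nb_fixed -(card_imset _ (@fperm_inj n I h)); apply: eq_card => f.
have fixJ f' : (fperm f' (g ^ h)%g == f') = (fperm (fperm f' h) g == fperm f' h).
  by rewrite conjgE !fpermM -(inj_eq (@fperm_inj _ _ h)) fpermVK.
have typeJ f' : [forall i, ftype (fperm f' h) i == nu i] = [forall i, ftype f' i == nu i].
  by apply: eq_forallb => i; rewrite ftype_perm.
apply/imsetP/idP => [[f'] | ]; first by rewrite !inE fixJ -typeJ => ? ->.
move=> fP; exists (fperm f h^-1%g); last by rewrite fpermVK.
by move: fP; rewrite !inE fixJ -(typeJ (fperm f h^-1%g)) fpermVK.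
Qed.

Lemma nb_fixedV (n : nat) (I : finType) (nu : I -> nat) (g : 'S_n) :
  nb_fixed nu g^-1%g = nb_fixed nu g.
Proof. by rewrite /nb_fixed; apply: eq_card => f; rewrite !inE fperm_fixV. Qed.

(** * Multiplicities in Young permutation modules *)

Section SpechtCharacter.
Variables (n : nat) (la : seq nat).
Hypothesis hla : is_partition n la.
Local Notation row k := (reshape_index la k).
Local Notation col k := (reshape_offset la k).
Local Notation R := (row_stab n la).
Local Notation Q := (col_stab n la).
Variable N : nat.
Local Notation fT := {ffun 'I_n -> 'I_N.+1}.
Implicit Types (f : fT) (nu : 'I_N.+1 -> nat).

(** The diagonal entry at f of the Young symmetrizer acting on the functions from n points to N + 1
    colours. *)
Definition signed_fixed f : algC :=
  \sum_(r in R) \sum_(c in Q) (-1) ^+ odd_perm c * (fperm f (r * c)%g == f)%:R.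

Lemma specht_char_nb_fixed nu :
  young_const n la * (\sum_(g : 'S_n) specht_char la g * (nb_fixed nu g)%:R) =
  n`!%:R * \sum_(f : fT | [forall i, ftype f i == nu i]) signed_fixed f.
Proof.
rewrite specht_char_dot // => [|g h]; last by rewrite nb_fixedJ.
congr (_ * _); rewrite /young_coef.
under eq_bigr do rewrite nb_fixedV big_distrl.
rewrite exchange_big /signed_fixed [RHS]exchange_big /=; apply: eq_bigr => r _.
under eq_bigr do rewrite big_distrl.
rewrite exchange_big [RHS]exchange_big /=; apply: eq_bigr => c _.
rewrite (bigD1 (r * c)%g) //= eqxx mulr1 big1 ?addr0 => [|g ng]; last first.
  by rewrite eq_sym (negPf ng) mulr0 mul0r.
rewrite -big_distrr; congr (_ * _); rewrite -natr_sum; congr (_%:R).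
rewrite /nb_fixed -sum1dep_card big_mkcond [RHS]big_mkcond /=.
by apply: eq_bigr => f _; rewrite andbC; case: forallP; case: eqP.
Qed.

(** Multiplying c by the transposition of k and k' reverses the sign and does not change the
    fixed-point condition. *)
Lemma signed_fixed0 f (k k' : 'I_n) :
  k != k' -> col k = col k' -> f k = f k' -> signed_fixed f = 0.
Proof.
move=> nk ek ef; apply: big1 => r _; set X := \sum_(c in Q) _.
have Qt : tperm k k' \in Q by apply/col_stabP=> x; case: tpermP => // ->.
have ft : fperm f (tperm k k') = f.
  by apply/ffunP=> x; rewrite ffunE; case: tpermP => // ->.
suff XN : X = - X by apply/eqP; rewrite -eqNr -XN.
rewrite {1}/X (reindex_inj (mulIg (tperm k k'))) /= /X -sumrN.
apply: eq_big => [c | c _]; first by rewrite groupMr.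
rewrite odd_permM odd_tperm nk signr_addb expr1 mulrN1 mulNr.
by rewrite mulgA [fperm _ (_ * tperm k k')%g]fpermM ft.
Qed.

Lemma signed_fixed_col f :
  signed_fixed f = 0 \/ col_injective la (fun k => f k : nat).
Proof.
case: (pickP [pred p : 'I_n * 'I_n |
   [&& p.1 != p.2, col p.1 == col p.2 & f p.1 == f p.2]]) => [[k k'] | none].
  by case/and3P => /= nk /eqP ek /eqP ef; left; apply: signed_fixed0 nk ek ef.
right=> k k' ek ef; apply/eqP/negPn/negP=> nk.
by have := none (k, k'); rewrite /= nk ek eqxx -val_eqE /= ef eqxx.
Qed.

Lemma card_lt_sum (g : 'I_n -> nat) j :
  #|[set k : 'I_n | (g k < j)%N]| = (\sum_(i < j) #|[set k : 'I_n | g k == i]|)%N.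
Proof.
elim: j => [|j IH]; first by rewrite big_ord0; apply: eq_card0 => k; rewrite inE.
rewrite big_ord_recr /= -IH -cardsUI [X in (_ = _ + X)%N](_ : _ = 0)%N ?addn0.
  by apply: eq_card => k; rewrite !inE ltnS leq_eqVlt orbC.
by apply: eq_card0 => k; rewrite !inE; case: ltngtP.
Qed.

(** Only column-injective f contribute, and such an f takes values at most j no more often than
    there are boxes in the first j + 1 rows; here [nu] asks for more. *)
Lemma specht_char_nb_fixed_lex nu (j : 'I_N.+1) :
    (forall i : 'I_N.+1, i < j -> nu i = nth 0 la i)%N -> (nth 0 la j < nu j)%N ->
  \sum_(g : 'S_n) specht_char la g * (nb_fixed nu g)%:R = 0.
Proof.
move=> eq_nu lt_nu; apply: (mulfI (young_const_neq0 hla)).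
rewrite mulr0 specht_char_nb_fixed big1 ?mulr0 // => f /forallP tf.
case: (signed_fixed_col f) => // f_inj.
have := col_injective_card hla j.+1 f_inj.
rewrite !card_lt_sum !big_ord_recr /= leqNgt => /negP[].
have cE (i : 'I_N.+1) : #|[set k | (f k : nat) == i]| = nu i.
  by rewrite -(eqP (tf i)); apply: eq_card => k; rewrite !inE.
rewrite cE card_row // -addnS leq_add // leq_eqVlt; apply/orP; left; apply/eqP.
apply: eq_bigr => i _; have iN : (i < N.+1)%N by apply: ltn_trans (ltn_ord i) _.
rewrite (card_row hla).
exact: esym (etrans (cE (Ordinal iN)) (eq_nu (Ordinal iN) (ltn_ord i))).
Qed.

(** Multiplicity one: the contributing functions are the row function [f0] composed with the
    elements of Q, and their diagonal entries add up to [young_const]. *)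
Lemma specht_char_nb_fixed_part nu : (size la <= N.+1)%N ->
    (forall i : 'I_N.+1, nu i = nth 0%N la i) ->
  \sum_(g : 'S_n) specht_char la g * (nb_fixed nu g)%:R = n`!%:R.
Proof.
move=> sla nuE; apply: (mulfI (young_const_neq0 hla)).
rewrite specht_char_nb_fixed mulrC; congr (_ * _).
have row_lt (k : 'I_n) : (row k < N.+1)%N.
  by apply: leq_trans sla; apply: reshape_indexP; rewrite (sumn_partition hla).
pose f0 : fT := [ffun k : 'I_n => Ordinal (row_lt k)].
have f0E (k : 'I_n) : f0 k = row k :> nat by rewrite ffunE.
have f0_inj : {in Q &, injective (fperm f0)}.
  move=> c c' /col_stabP Qc /col_stabP Qc' /ffunP e; apply/permP=> k.
  apply: (@box_inj n la); last by rewrite Qc Qc'.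
  by have /(congr1 val) := e k; rewrite /= !ffunE.
have f0_type c i : ftype (fperm f0 c) i = nu i.
  by rewrite ftype_perm nuE -(card_row hla); apply: eq_card => k; rewrite !inE -val_eqE /= f0E.
transitivity (\sum_(f in [set fperm f0 c | c in Q]) signed_fixed f).
  rewrite [LHS]big_mkcond [RHS]big_mkcond /=; apply: eq_bigr => f _.
  have [ft | nft] := boolP [forall i, ftype f i == nu i]; last first.
    case: imsetP => // -[c _ fc]; case/forallPn: nft => i.
    by rewrite fc f0_type eqxx.
  case: imsetP => // nim; have [//| f_inj] := signed_fixed_col f; case: nim.
  have [|c Qc fc] := col_injective_row hla f_inj.
    move=> i; rewrite card_row //; case: (ltnP i N.+1) => iN.
      rewrite -(nuE (Ordinal iN)) -(eqP (forallP ft (Ordinal iN))).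
      by apply: eq_card => k; rewrite !inE.
    rewrite nth_default ?(leq_trans sla) //; apply: eq_card0 => k.
    by rewrite !inE ltn_eqF //; apply: leq_trans iN.
  by exists c => //; apply/ffunP=> k; apply: val_inj; rewrite ffunE /= fc f0E.
rewrite big_imset //= /young_const /young_sandwich_coef.
rewrite [RHS](reindex_inj invg_inj) /=; apply: eq_big => [c0 | c0 Qc0]; first by rewrite groupV.
apply: eq_bigr => r Rr; rewrite mulg1.
have -> : young_coef la (c0^-1 * r)%g =
    \sum_(c in Q) (-1) ^+ odd_perm c * ((c0^-1 * r * c^-1)%g \in R)%:R.
  rewrite /young_coef exchange_big /=; apply: eq_bigr => c Qc.
  rewrite -big_distrr; congr (_ * _).
  have [Rx | nRx] := boolP (_ \in R).
    rewrite (bigD1 _ Rx) /= mulgKV eqxx big1 ?addr0 // => r' /andP[_ nr].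
    by rewrite (can2_eq (mulgK _) (mulgKV _)) (negPf nr).
  apply: big1 => r' Rr'; case: eqP => // e; case/negP: nRx.
  by rewrite -e mulgK.
(* Substituting (c c0)^-1 for c turns the condition into c0^-1 r c c0 in R, which says that r c
   fixes [fperm f0 c0]. *)
rewrite big_distrr /= [RHS](reindex_inj invg_inj) [RHS](reindex_inj (mulIg c0)) /=.
apply: eq_big => [c | c Qc]; first by rewrite groupV groupMr.
rewrite mulrA -signr_addb !odd_permV odd_permM addbCA addbb addbF invgK.
congr (_ * _%:R).
have -> : (fperm (fperm f0 c0) (r * c) == fperm f0 c0) = ((c0^-1 * r * (c * c0))%g \in R).
  rewrite -fpermM -(inj_eq (@fperm_inj _ _ c0^-1%g)) -!fpermM mulVg fperm1 !mulgA.
  apply/eqP/row_stabP => [/ffunP e k | e].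
    by have /(congr1 val) := e k; rewrite /= !ffunE.
  by apply/ffunP=> k; apply: val_inj; rewrite /= !ffunE /= e.
by [].
Qed.

End SpechtCharacter.

(** * The Specht character as a Frobenius class function *)

Section SpechtOmega.
Variables (n : nat) (la : seq nat) (N : nat).
Hypothesis hla : is_partition n la.
Hypothesis sla : (size la <= N.+1)%N.

Definition shifted_part : {ffun 'I_N.+1 -> 'I_(N + n).+1} :=
  [ffun i : 'I_N.+1 => inord (nth 0 la i + (N - i))%N].

Lemma shifted_partE (i : 'I_N.+1) : shifted_part i = (nth 0 la i + (N - i))%N :> nat.
Proof. by rewrite ffunE inordK // ltnS addnC leq_add ?leq_subr ?nth_partition_le_n. Qed.

Lemma shifted_part_sdec : strictly_decreasing shifted_part.
Proof.
move=> i j ij; rewrite !shifted_partE.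
by have := nth_partition_le hla (ltnW ij); have := ltn_ord j; lia.
Qed.

Lemma sum_partition : (\sum_(i < N.+1) nth 0 la i = n)%N.
Proof.
rewrite -(sumn_partition hla) sumnE (big_nth 0%N) !big_mkord.
rewrite (big_ord_widen _ (fun i => nth 0 la i) sla) [LHS](bigID (fun i : 'I_N.+1 => i < size la)%N) /=.
by rewrite addnC big1 // => i; rewrite -leqNgt => ?; rewrite nth_default.
Qed.

Lemma weight_shifted_part : weight shifted_part = (weight (staircase N (N + n)) + n)%N.
Proof.
transitivity (weight (staircase N (N + n)) + \sum_(i < N.+1) nth 0 la i)%N.
  rewrite /weight -big_split /=; apply: eq_bigr => i _.
  by rewrite shifted_partE (staircaseE (leqnn _)) addnC.
by rewrite sum_partition.
Qed.

(** In the Jacobi-Trudi expansion of omega, w = 1 gives multiplicity one. For any other w, the first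
    j that it moves has w j > j, so entry j of nu exceeds the part and the term vanishes. *)
Lemma specht_char_omega_dot :
  \sum_(g : 'S_n) specht_char la g * omega shifted_part g = n`!%:R.
Proof.
under eq_bigr do rewrite omega_nb_fixedE big_distrr.
rewrite exchange_big /=.
under eq_bigr do under eq_bigr do rewrite mulrCA.
under eq_bigr do rewrite -big_distrr /=.
have stE (i : 'I_N.+1) : staircase N (N + n) i = (N - i)%N :> nat.
  exact: staircaseE (leqnn _) i.
rewrite (bigD1 1%g) /=; last first.
  by apply/forallP=> i; rewrite perm1 stE shifted_partE leq_addl.
rewrite odd_perm1 mul1r (specht_char_nb_fixed_part hla sla) => [|i]; last first.
  by rewrite perm1 stE shifted_partE addnK.
rewrite big1 ?addr0 // => w /andP[/forallP okw nw].
have [j0 bad0] : exists j, w j != j.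
  apply/existsP; apply: contraR nw; rewrite negb_exists => /forallP h.
  by apply/eqP/permP=> j; rewrite perm1; apply/eqP; have := h j; rewrite negbK.
case: (@arg_minnP _ j0 (fun j => w j != j) (fun j : 'I_N.+1 => j : nat) bad0) => j badj minj.
have good (i : 'I_N.+1) : (i < j)%N -> w i = i.
  move=> ij; apply/eqP; have : ~~ (w i != i) by apply: contraL ij => /minj; rewrite -leqNgt.
  by rewrite negbK.
have wj : (j <= w j)%N.
  rewrite leqNgt; apply/negP => wj; have e := good _ wj.
  by move: wj; rewrite (perm_inj e) ltnn.
rewrite (specht_char_nb_fixed_lex (j := j) hla) ?mulr0 // => [i ij|].
  by rewrite good // stE shifted_partE addnK.
have := okw j; rewrite !stE shifted_partE.
by move: badj; rewrite -val_eqE /= => nwj; have := ltn_ord (w j); lia.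
Qed.

Lemma specht_char_conj (g : 'S_n) : specht_char la g^-1%g = (specht_char la g)^*.
Proof.
have E x : specht_char la x = cfRepr (specht_repr n la) x.
  by rewrite cfunE inE mulr1n.
by rewrite !E char_inv ?cfRepr_char.
Qed.

Lemma specht_charE_omega (g : 'S_n) : specht_char la g = omega shifted_part g.
Proof.
have oR s : (omega shifted_part s)^* = omega shifted_part s.
  rewrite rmorph_sum; apply: eq_bigr => w _.
  by rewrite rmorphM rmorph_sign rmorph_nat.
have normE : \sum_(s : 'S_n) `|specht_char la s - omega shifted_part s| ^+ 2 = 0.
  under eq_bigr do rewrite normCK rmorphB /= oR -specht_char_conj mulrBr !mulrBl.
  rewrite !sumrB (specht_char_norm hla) specht_char_omega_dot.
  rewrite (omega_orthonormal (leqnn _) shifted_part_sdec shifted_part_sdec) ?weight_shifted_part //.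
  under eq_bigr do rewrite specht_char_conj -[omega _ _]oR -rmorphM mulrC /=.
  by rewrite -rmorph_sum specht_char_omega_dot eqxx mulr1 rmorph_nat subrr.
have : `|specht_char la g - omega shifted_part g| ^+ 2 = 0.
  by apply: (psumr_eq0P _ normE) => // s _; apply: exprn_ge0.
by move/eqP; rewrite sqrf_eq0 normr_eq0 subr_eq0 => /eqP.
Qed.

End SpechtOmega.

(** * Hook lengths *)

Section Hooks.
Variables (n : nat) (la : seq nat) (N : nat).
Hypothesis hla : is_partition n la.
Hypothesis sla : (size la <= N.+1)%N.

Lemma lt_count_sorted (s : seq nat) (c j : nat) : sorted geq s ->
  (j < count (fun l => c < l) s)%N = (c < nth 0 s j)%N.
Proof.
elim: s j => [|x s IH] j /=; first by rewrite nth_nil ltn0.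
rewrite path_sortedE => [/andP[x_max s_sorted]|]; last first.
  by move=> a b d /= h1 h2; apply: leq_trans h2 h1.
have [cx | xc] := ltnP c x; first by case: j => // j; rewrite /= add1n ltnS IH.
have c0 : count (fun l => c < l)%N s = 0%N.
  apply/eqP; rewrite -leqn0 leqNgt -has_count; apply/hasPn => y ys.
  by rewrite -leqNgt; apply: leq_trans xc; apply: (allP x_max).
rewrite c0 addn0 ltn0; case: j => [|j] /=; first by rewrite ltnNge xc.
by rewrite -IH // c0 ltn0.
Qed.

Local Notation height c := (count (fun l => c < l)%N la).

Lemma lt_height c j : (j < height c)%N = (c < nth 0 la j)%N.
Proof. by apply: lt_count_sorted; have /and3P[] := hla. Qed.

Lemma nth_conj_part c : nth 0%N (conj_part la) c = height c.
Proof.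
rewrite /conj_part; case: (ltnP c (head 0%N la)) => hc.
  by rewrite (nth_map 0%N) ?size_iota // nth_iota // add0n.
rewrite nth_default ?size_map ?size_iota //; apply/esym/eqP.
by rewrite -leqn0 leqNgt lt_height nth0 -leqNgt.
Qed.

(** The hook length in additive form, free of truncated subtraction. *)
Lemma hookE i c : (c < nth 0 la i)%N ->
  (hook la (i, c) + i + c + 1 = nth 0 la i + height c)%N.
Proof.
move=> ci; rewrite /hook /= nth_conj_part.
by move: (ci); rewrite -lt_height; lia.
Qed.

Definition beta i := (nth 0 la i + (N - i))%N.

Lemma beta_lt i j : (i < j <= N)%N -> (beta j < beta i)%N.
Proof.
move=> /andP[ij jN]; have := nth_partition_le hla (ltnW ij); rewrite /beta; lia.
Qed.

(* The hook at (i, c) is never beta i - beta j, since height c - c - 1 and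
   j - nth 0 la j are separated by whether or not j < height c. *)
Lemma perm_hooks_row i : (i <= N)%N ->
  perm_eq ([seq hook la (i, c) | c <- iota 0 (nth 0 la i)%N] ++
           [seq (beta i - beta j)%N | j <- iota i.+1 (N - i)])
          (iota 1 (beta i)).
Proof.
move=> iN; set s1 := map _ _; set s2 := map _ _.
have height_le c : (height c <= N.+1)%N by apply: leq_trans (count_size _ _) sla.
have height_anti c c' : (c <= c')%N -> (height c' <= height c)%N.
  by move=> cc; apply: sub_count => x; apply: leq_ltn_trans.
have u1 : uniq s1.
  rewrite map_inj_in_uniq ?iota_uniq // => c c'; rewrite !mem_iota /= !add0n => ci ci' e.
  have := hookE ci; have := hookE ci'; rewrite e.
  by case: (ltngtP c c') => // lt; have := height_anti _ _ (ltnW lt); lia.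
have u2 : uniq s2.
  rewrite map_inj_in_uniq ?iota_uniq // => j j'; rewrite !mem_iota /= => ji ji' e.
  have h : (beta j <= beta i)%N by apply: ltnW; apply: beta_lt; lia.
  have h' : (beta j' <= beta i)%N by apply: ltnW; apply: beta_lt; lia.
  have ejj : beta j = beta j' by lia.
  case: (ltngtP j j') => // jj.
    have : (beta j' < beta j)%N by apply: beta_lt; lia.
    by rewrite ejj ltnn.
  have : (beta j < beta j')%N by apply: beta_lt; lia.
  by rewrite ejj ltnn.
have u12 : uniq (s1 ++ s2).
  rewrite cat_uniq u1 u2 andbT /=; apply/hasPn => x /mapP[j].
  rewrite mem_iota => ji ->; apply/negP => /mapP[c]; rewrite mem_iota /= add0n => ci e.
  have := hookE ci; rewrite -e /beta.
  have : (beta j < beta i)%N by apply: beta_lt; lia.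
  rewrite /beta; case: (ltnP j (height c)) => jc.
    by move: (jc); rewrite lt_height; lia.
  by move: (jc); rewrite leqNgt lt_height -leqNgt; lia.
have sub : {subset s1 ++ s2 <= iota 1 (beta i)}; last first.
  apply: uniq_perm => //; first exact: iota_uniq.
  have [] := uniq_min_size u12 sub; last by [].
  by rewrite size_cat !size_map !size_iota /beta.
move=> x; rewrite mem_cat => /orP[/mapP[c] | /mapP[j]]; rewrite !mem_iota.
  rewrite /= add0n => ci ->; have := hookE ci; rewrite /beta.
  by move: (ci); rewrite -lt_height; move: (height_le c); lia.
move=> ji ->; have : (beta j < beta i)%N by apply: beta_lt; lia.
by lia.
Qed.

Lemma big_boxes (R : Type) (idx : R) (op : Monoid.com_law idx) (F : nat * nat -> R) :
  \big[op/idx]_(b <- boxes la) F b =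
  \big[op/idx]_(i < N.+1) \big[op/idx]_(c < nth 0%N la i) F ((i : nat), (c : nat)).
Proof.
rewrite /boxes big_allpairs_dep /=.
have E (m : nat) (G : nat -> R) : \big[op/idx]_(j <- iota 0 m) G j = \big[op/idx]_(j < m) G j.
  by rewrite -(big_mkord xpredT G) /index_iota subn0.
rewrite E (big_ord_widen _ (fun i => \big[op/idx]_(j <- iota 0 (nth 0%N la i)) F (i, j)) sla).
rewrite big_mkcond; apply: eq_bigr => i _ /=; case: ltnP => [_ | ?]; first exact: E.
by rewrite nth_default // big_ord0.
Qed.

Variables (K : fieldType) (q : K).

Lemma prod_hook_row i : (i <= N)%N ->
  (\prod_(c < nth 0%N la i) (1 - q ^+ hook la (i, c : nat))) *
    \prod_(j < N.+1 | (i < j)%N) (1 - q ^+ (beta i - beta j)) =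
  \prod_(k <- iota 1 (beta i)) (1 - q ^+ k).
Proof.
move=> iN; rewrite -(perm_big _ (perm_hooks_row iN)) big_cat !big_map /=; congr (_ * _).
  by rewrite -(big_mkord xpredT (fun c => 1 - q ^+ hook la (i, c))) /index_iota subn0.
have -> : iota i.+1 (N - i) = index_iota i.+1 N.+1 by rewrite /index_iota subSS.
by rewrite (big_nat_widenl i.+1 0) // big_mkord.
Qed.
End Hooks.

(** * Principal specialization *)

Section PrincipalSpecialization.
Variables (K : fieldType) (q : K).
Hypothesis q_neq0 : q != 0.
Hypothesis q_free : forall k, (0 < k)%N -> 1 - q ^+ k != 0.

(** A Vandermonde determinant in the q^(l j). Each difference q^(l j) - q^(l i) with i < j yields a
    factor q^(l j), so this factor is taken out j times. *)
Lemma det_powers (N : nat) (l : 'I_N.+1 -> nat) :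
    (forall i j : 'I_N.+1, i < j -> l j < l i)%N ->
  \det (\matrix_(i, j) (q ^+ i) ^+ l j) =
  q ^+ (\sum_(j < N.+1) j * l j) *
    \prod_(i < N.+1) \prod_(j < N.+1 | (i < j)%N) (1 - q ^+ (l i - l j)).
Proof.
move=> ld; have -> : \matrix_(i, j) (q ^+ i) ^+ l j = Vandermonde N.+1 (\row_j q ^+ l j).
  by apply/matrixP=> i j; rewrite !mxE exprAC.
rewrite det_Vandermonde.
transitivity (\prod_(i < N.+1) \prod_(j < N.+1 | (i < j)%N)
    (q ^+ l j * (1 - q ^+ (l i - l j)))).
  apply: eq_bigr => i _; apply: eq_bigr => j ij.
  by rewrite !mxE mulrBr mulr1 -exprD subnKC // ltnW // ld.
under eq_bigr do rewrite big_split.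
rewrite big_split /=; congr (_ * _); rewrite (exchange_big_dep xpredT) //= -prodrXr.
apply: eq_bigr => j _; rewrite (big_ord_narrow (ltnW (ltn_ord j))).
by rewrite prodr_const card_ord mulnC exprM.
Qed.

Variables (n : nat) (la : seq nat) (N : nat).
Hypothesis hla : is_partition n la.
Hypothesis sla : (size la <= N.+1)%N.
Variable emb : {rmorphism algC -> K}.

Lemma n_statE : n_stat la = (\sum_(i < N.+1) i * nth 0 la i)%N.
Proof.
rewrite /n_stat (big_ord_widen _ (fun i => i * nth 0 la i)%N sla) big_mkcond.
by apply: eq_bigr => i _; case: ltnP => // ?; rewrite nth_default ?muln0.
Qed.

(** This is [prod_hook_row] for the empty partition, whose shift is the staircase. *)
Lemma prod_staircase_row (i : 'I_N.+1) :
  \prod_(j < N.+1 | (i < j)%N) (1 - q ^+ ((N - i) - (N - j))) =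
  \prod_(k <- iota 1 (N - i)) (1 - q ^+ k).
Proof.
have h0 : is_partition 0 [::] by [].
have iN : (i <= N)%N by rewrite -ltnS.
have := prod_hook_row h0 (leq0n N.+1) q iN.
rewrite nth_nil big_ord0 mul1r /beta nth_nil add0n => <-.
by apply: eq_bigr => j _; rewrite nth_nil.
Qed.

Lemma prod_content_row (i : 'I_N.+1) :
  \prod_(k <- iota 1 (beta la N i)) (1 - q ^+ k) =
  (\prod_(k <- iota 1 (N - i)) (1 - q ^+ k)) *
  \prod_(c < nth 0%N la i) (1 - q ^+ (N.+1 + c - i)).
Proof.
rewrite /beta addnC iotaD big_cat /=; congr (_ * _).
rewrite -[(1 + (N - i))%N]addn0 iotaDl big_map.
rewrite -(big_mkord xpredT (fun c => 1 - q ^+ (N.+1 + c - i))) /index_iota subn0.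
by apply: eq_bigr => c _; congr (1 - q ^+ _); have := ltn_ord i; lia.
Qed.

(** The bialternant formula at x_i = q^i, with the nonzero denominator D cancelled. In row i the
    hooks complete the numerator to the product of 1 - q^k for k <= beta i, the denominator has k <=
    N - i, and the quotient runs over the exponents N + 1 + content. *)
Lemma specht_char_power_fixed :
  (\sum_(s : 'S_n) emb (specht_char la s) * power_fixed (fun i : 'I_N.+1 => q ^+ i) s) *
    \prod_(b <- boxes la) (1 - q ^+ hook la b) =
  n`!%:R * (q ^+ n_stat la * \prod_(b <- boxes la) (1 - q ^+ (N.+1 + b.2 - b.1))).
Proof.
have stE (i : 'I_N.+1) : staircase N (N + n) i = (N - i)%N :> nat.
  exact: staircaseE (leqnn _) i.
have dst : forall i j : 'I_N.+1, (i < j -> staircase N (N + n) j < staircase N (N + n) i)%N.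
  by move=> i j ij; rewrite !stE; have := ltn_ord j; lia.
have ld := shifted_part_sdec hla sla.
set D := \det (\matrix_(i, j) (q ^+ i) ^+ staircase N (N + n) j).
have DE : D = q ^+ (\sum_(j < N.+1) j * (N - j)) *
    \prod_(i < N.+1) \prod_(k <- iota 1 (N - i)) (1 - q ^+ k).
  rewrite /D det_powers //; congr (q ^+ _ * _).
    by apply: eq_bigr => j _; rewrite stE.
  apply: eq_bigr => i _; rewrite -prod_staircase_row.
  by apply: eq_bigr => j _; rewrite !stE.
have D0 : D != 0.
  rewrite DE mulf_neq0 ?expf_neq0 // prodf_seq_neq0; apply/allP=> i _ /=.
  rewrite prodf_seq_neq0; apply/allP=> k; rewrite mem_iota => /andP[k0 _].
  exact: q_free.
apply: (mulfI D0); rewrite [LHS]mulrA.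
under [X in D * X]eq_bigr => s _ do rewrite (specht_charE_omega hla sla).
rewrite (omega_bialternant (leqnn _)) ?weight_shifted_part //.
rewrite [RHS]mulrCA -mulrA; congr (_ * _); rewrite DE (det_powers ld).
rewrite !(big_boxes sla) -mulrA mulrACA -[in RHS]exprD; congr (_ * _).
  congr (q ^+ _); rewrite n_statE -big_split; apply: eq_bigr => j _ /=.
  by rewrite shifted_partE // mulnDr addnC.
rewrite -!big_split; apply: eq_bigr => i _ /=.
rewrite -prod_content_row mulrC -(prod_hook_row hla sla q) ?leq_ord //.
by congr (_ * _); apply: eq_bigr => j _; rewrite !shifted_partE.
Qed.

End PrincipalSpecialization.

(** * Products over cycles *)

Section Cycles.
Variables (n : nat) (s : 'S_n).

Lemma porbit_class (c : {set 'I_n}) : c \in porbits s ->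
  [set k | porbit s k == c] = c.
Proof.
move=> /imsetP[k0 _ ->]; apply/setP=> k.
by rewrite inE eq_porbit_mem porbit_sym.
Qed.

Lemma prod_porbits (R : comPzRingType) (F : 'I_n -> R) :
  \prod_k F k = \prod_(c in porbits s) \prod_(k in c) F k.
Proof.
rewrite (partition_big (porbit s) (mem (porbits s))) /=; last first.
  by move=> k _; apply: imset_f.
apply: eq_bigr => c cP; apply: eq_bigl => k.
by rewrite -[in RHS](porbit_class cP) inE.
Qed.

Lemma sum_card_porbits : (\sum_(c in porbits s) #|c| = n)%N.
Proof.
rewrite -[RHS](card_ord n) -sum1_card (partition_big (porbit s) (mem (porbits s))) /=.
  apply: eq_bigr => c cP; rewrite sum1dep_card -[in LHS](porbit_class cP).
  by apply: eq_card => k; rewrite !inE.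
by move=> k _; apply: imset_f.
Qed.

Lemma fperm_porbit (I : finType) (f : {ffun 'I_n -> I}) k k' :
  fperm f s = f -> k' \in porbit s k -> f k' = f k.
Proof.
move=> ff /porbitP[i ->]; elim: i => [|i IH]; first by rewrite expg0 perm1.
by rewrite expgSr permM -IH -[in RHS]ff ffunE.
Qed.

(** A function is fixed by s exactly when it is constant on cycles, so it amounts to one colour per
    cycle. *)
Lemma power_fixed_porbits (N : nat) (K : fieldType) (x : 'I_N.+1 -> K) :
  power_fixed x s = \prod_(c in porbits s) \sum_i x i ^+ #|c|.
Proof.
rewrite (big_distr_big ord0) /=.
pose to_f (g : {ffun {set 'I_n} -> 'I_N.+1}) := [ffun k => g (porbit s k)].
(* The value [ord0] off the cycles is the default that [big_distr_big] was given. *)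
pose to_g (f : {ffun 'I_n -> 'I_N.+1}) : {ffun {set 'I_n} -> 'I_N.+1} :=
  [ffun c => if c \in porbits s then oapp f ord0 [pick k in c] else ord0].
rewrite /power_fixed (reindex_onto to_f to_g) => [|f /eqP ff]; last first.
  apply/ffunP=> k; rewrite !ffunE imset_f //; case: pickP => [k' | /(_ k)] /=.
    exact: fperm_porbit.
  by rewrite porbit_id.
have to_fK g c : c \in porbits s -> to_g (to_f g) c = g c.
  move=> cP; rewrite ffunE cP; move: (cP) => /imsetP[k0 _ ec].
  case: pickP => [k kc /= | /(_ k0)]; last by rewrite ec porbit_id.
  by rewrite ffunE; congr (g _); apply/eqP; move: kc; rewrite -{1}(porbit_class cP) inE.
apply: eq_big => [g | g /andP[_ /eqP gg]].
  have -> /= : fperm (to_f g) s == to_f g.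
    apply/eqP/ffunP=> k; rewrite !ffunE; congr (g _).
    by have := porbit_perm s 1 k; rewrite expg1.
  apply/eqP/pffun_onP => [<- | [sg _]].
    split; last by move=> y _.
    by apply/subsetP=> c; rewrite !inE ffunE; case: ifP; rewrite ?eqxx.
  apply/ffunP=> c; have [cP | ncP] := boolP (c \in porbits s); first exact: to_fK.
  rewrite ffunE (negPf ncP); apply/esym/eqP; apply: contraNT ncP => gc.
  by apply: (subsetP sg); rewrite inE.
rewrite prod_porbits; apply: eq_bigr => c cP.
rewrite (eq_bigr (fun=> x (g c))) => [|k kc]; first by rewrite prodr_const.
rewrite ffunE; congr (x (g _)); apply/eqP.
by move: kc; rewrite -{1}(porbit_class cP) inE.
Qed.

End Cycles.

Lemma poly_eq_geometric (K : fieldType) (q : K) (p r : {poly K}) (m : nat) :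
    q != 0 -> (forall k, (0 < k)%N -> 1 - q ^+ k != 0) ->
    (forall N, (m <= N)%N -> p.[q ^+ N] = r.[q ^+ N]) ->
  p = r.
Proof.
move=> q0 q_free pr; apply/eqP; rewrite -subr_eq0; apply/negPn/negP => nz.
(* These are distinct roots of p - r, one more than its degree allows. *)
pose rs := [seq q ^+ N | N <- iota m (size (p - r))].
have u_rs : uniq rs.
  rewrite map_inj_uniq ?iota_uniq // => a b.
  wlog ab : a b / (a <= b)%N => [hw e|e].
    by case: (leqP a b) => [/hw -> // | /ltnW/hw -> //].
  apply/eqP; rewrite eqn_leq ab /= leqNgt; apply/negP => lt.
  have := q_free (b - a)%N; rewrite subn_gt0 lt => /(_ isT)/eqP[].
  by apply: (mulfI (expf_neq0 a q0)); rewrite mulrBr mulr1 -exprD subnKC // e subrr mulr0.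
have all_rs : all (root (p - r)) rs.
  apply/allP=> _ /mapP[N + ->]; rewrite mem_iota => /andP[mN _].
  by rewrite /root !hornerE pr // subrr.
by have := max_poly_roots nz all_rs u_rs; rewrite size_map size_iota ltnn.
Qed.

(** * Extension to arbitrary t *)

Section Specialization.
Variables (K : fieldType) (q : K).
Hypothesis q_neq0 : q != 0.
Hypothesis q_free : forall k, (0 < k)%N -> 1 - q ^+ k != 0.
Variables (n : nat) (la : seq nat).
Hypothesis hla : is_partition n la.
Variable emb : {rmorphism algC -> K}.

Lemma porbits_neq0 (s : 'S_n) c : c \in porbits s -> 1 - q ^+ #|c| != 0.
Proof.
by move=> /imsetP[k _ ->]; apply: q_free; rewrite lt0n card_porbit_neq0.
Qed.

(** At t = q^(N+1) the factor of a cycle of length m is the sum of q^(im) over i <= N, the power sum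
    of the principal specialization. *)
Lemma specht_char_specialization (t : K) :
  (\sum_(s : 'S_n) emb (specht_char la s) *
     \prod_(c in porbits s) ((1 - t ^+ #|c|) / (1 - q ^+ #|c|))) *
    \prod_(b <- boxes la) (1 - q ^+ hook la b) =
  n`!%:R * (q ^+ n_stat la * \prod_(b <- boxes la) (1 - t * q ^ content b)).
Proof.
pose p : {poly K} := (\sum_(s : 'S_n) (emb (specht_char la s))%:P *
   \prod_(c in porbits s) ((1 - 'X^#|c|) * ((1 - q ^+ #|c|)^-1)%:P)) *
   (\prod_(b <- boxes la) (1 - q ^+ hook la b))%:P.
pose r : {poly K} := (n`!%:R * q ^+ n_stat la)%:P *
   \prod_(b <- boxes la) (1 - 'X * (q ^ content b)%:P).
have pE x : p.[x] = (\sum_(s : 'S_n) emb (specht_char la s) *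
     \prod_(c in porbits s) ((1 - x ^+ #|c|) / (1 - q ^+ #|c|))) *
    \prod_(b <- boxes la) (1 - q ^+ hook la b).
  rewrite /p hornerM hornerC horner_sum; congr (_ * _); apply: eq_bigr => s _.
  rewrite hornerM hornerC horner_prod; congr (_ * _); apply: eq_bigr => c _.
  by rewrite !hornerE.
have rE x : r.[x] = n`!%:R * (q ^+ n_stat la * \prod_(b <- boxes la) (1 - x * q ^ content b)).
  rewrite /r hornerM hornerC horner_prod mulrA; congr (_ * _).
  by apply: eq_bigr => b _; rewrite !hornerE.
rewrite -pE -rE; congr (_.[t]).
(* This starting exponent makes the number N + 1 of variables positive and no smaller than the
   number of rows. *)
apply: (poly_eq_geometric (m := (size la).+1) q_neq0 q_free) => [[//|N]] slaN.
have sla : (size la <= N.+1)%N by apply: ltnW.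
rewrite pE rE.
transitivity (n`!%:R * (q ^+ n_stat la * \prod_(b <- boxes la) (1 - q ^+ (N.+1 + b.2 - b.1)))).
  rewrite -(specht_char_power_fixed q_neq0 q_free hla sla emb); congr (_ * _).
  apply: eq_bigr => s _; rewrite power_fixed_porbits; congr (_ * _).
  apply: eq_bigr => c cP; have nz := porbits_neq0 cP.
  apply: (mulIf nz); rewrite divfK // mulrC.
  under eq_bigr do rewrite exprAC.
  by rewrite -[1 - q ^+ _]opprB mulNr -subrX1 opprB exprAC.
congr (_ * (_ * _)); rewrite !big_seq; apply: eq_bigr => -[i j].
case/allpairsPdep => i' [j' [+ _ [-> ->]]]; rewrite mem_iota /= add0n => ila.
have iN : (i' < N.+1)%N by apply: leq_trans sla.
congr (1 - _); rewrite !exprnP -expfzDr //; congr (q ^ _).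
by rewrite /content /=; lia.
Qed.

End Specialization.

(** * Determinants of signed permutations *)

Section WeightedPermutation.
Variables (R : comNzRingType) (n : nat) (s : 'S_n).
Implicit Types (d : 'I_n -> R) (A B : {set 'I_n}).

Definition partial_perm_mx d A : 'M[R]_n :=
  \matrix_(i, j) (d i *+ ((i \in A) && (s i == j))).

(** The cross term vanishes, because s leads from A only into A. Thus the determinant splits over
    cycles. *)
Lemma partial_perm_mxU d A B : [disjoint A & B] ->
    (forall i, (s i \in A) = (i \in A)) ->
  (1%:M - partial_perm_mx d A) *m (1%:M - partial_perm_mx d B) =
  1%:M - partial_perm_mx d (A :|: B).
Proof.
move=> dAB sA.
have -> : partial_perm_mx d (A :|: B) = partial_perm_mx d A + partial_perm_mx d B.
  apply/matrixP=> i j; rewrite !mxE inE.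
  have [iA | niA] /= := boolP (i \in A); last by rewrite mulr0n add0r.
  by rewrite (disjointFr dAB iA) /= addr0.
have AB0 : partial_perm_mx d A *m partial_perm_mx d B = 0.
  apply/matrixP=> i j; rewrite !mxE big1 // => k _; rewrite !mxE.
  have [iA | niA] /= := boolP (i \in A); last by rewrite mulr0n mul0r.
  case: eqP => [<- | _]; last by rewrite mulr0n mul0r.
  by rewrite (disjointFr dAB) ?sA // mulr0n mulr0.
rewrite mulmxBr mulmx1 mulmxBl mul1mx AB0 subr0 opprD addrA.
by rewrite addrAC.
Qed.

Lemma porbit_stable k i : (s i \in porbit s k) = (i \in porbit s k).
Proof.
rewrite -!eq_porbit_mem; congr (_ == _).
by have := porbit_perm s 1 i; rewrite expg1.
Qed.

(* In the Leibniz expansion only the identity and the cycle itself survive, so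
   the determinant is [1 + kappa * \prod d] with kappa independent of d;
   kappa = -1 because the matrix is singular when all weights are 1. *)
Lemma det_cycle d k :
  \det (1%:M - partial_perm_mx d (porbit s k)) = 1 - \prod_(i in porbit s k) d i.
Proof.
set c := porbit s k.
have cS i : (s i \in c) = (i \in c) := porbit_stable k i.
have termE d' (t : 'S_n) : \prod_i (1%:M - partial_perm_mx d' c) i (t i) =
    \prod_i ((i == t i)%:R - d' i *+ ((i \in c) && (s i == t i))).
  by apply: eq_bigr => i _; rewrite !mxE.
(* A fixed point is treated apart: its cycle is the identity, so the two surviving permutations
   coincide. *)
have [sk | nsk] := eqVneq (s k) k.
  have ck i : (i \in c) = (i == k).
    apply/idP/eqP => [/porbitP[m ->] | ->]; last exact: porbit_id.
    by elim: m => [|m IH]; rewrite ?expg0 ?perm1 // expgSr permM IH.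
  rewrite /determinant (bigD1 1%g) //= [X in _ + X]big1 ?addr0 => [|t nt].
    rewrite odd_perm1 mul1r termE (bigD1 k) //= [X in _ * X]big1 => [|i ik].
      by rewrite perm1 eqxx ck eqxx sk eqxx mulr1 (big_pred1 k).
    by rewrite perm1 eqxx ck (negPf ik) subr0.
  rewrite termE; have [i ni] : exists i, t i != i.
    apply/existsP; apply: contraR nt; rewrite negb_exists => /forallP h.
    by apply/eqP/permP=> i; rewrite perm1; apply/eqP; have := h i; rewrite negbK.
  have [j [nj jk]] : exists j, t j != j /\ j != k.
    have [ik | ik] := eqVneq i k; last by exists i.
    exists (t i); rewrite (inj_eq perm_inj) ni; split=> //.
    by rewrite -ik.
  by rewrite (bigD1 j) //= eq_sym (negPf nj) ck (negPf jk) subr0 mul0r mulr0.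
have nsc i : i \in c -> s i != i.
  move=> ic; apply: contra nsk => /eqP si; apply/eqP.
  have : k \in porbit s i by rewrite porbit_sym.
  move=> /porbitP[m ->]; elim: m => [|m IH]; first by rewrite expg0 perm1.
  by rewrite expgSr permM IH.
pose f i := if i \in c then s i else i.
have f_inj : injective f.
  move=> i j; rewrite /f; case: ifP => ic; case: ifP => jc //.
  - exact: perm_inj.
  - by move=> e; rewrite -e cS ic in jc.
  - by move=> e; rewrite e cS jc in ic.
pose s0 := perm f_inj.
have s0E i : s0 i = if i \in c then s i else i by rewrite permE.
have ns0 : s0 != 1%g.
  apply/eqP=> /permP/(_ k); rewrite s0E porbit_id perm1.
  exact/eqP.
have detE d' : \det (1%:M - partial_perm_mx d' c) =
    1 + (-1) ^+ odd_perm s0 * (-1) ^+ #|c| * \prod_(i in c) d' i.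
  rewrite /determinant (bigD1 1%g) //= (bigD1 s0) //= addrA [X in _ + X]big1 ?addr0 => [|t /andP[nt nt0]].
    rewrite odd_perm1 mul1r !termE; congr (_ + _).
      rewrite big1 // => i _; rewrite perm1 eqxx.
      by case: (boolP (i \in c)) => [/nsc /negPf -> | _]; rewrite subr0.
    rewrite -mulrA; congr (_ * _); rewrite -prodrN [RHS]big_mkcond; apply: eq_bigr => i _.
    rewrite s0E; case: ifP => ic; last by rewrite eqxx subr0.
    by rewrite eq_sym (negPf (nsc _ ic)) eqxx sub0r.
  rewrite termE; apply/eqP/negPn/negP => nz.
  have fac i : (i == t i)%:R - d' i *+ ((i \in c) && (s i == t i)) != 0.
    apply: contraNN nz => /eqP e.
    by rewrite (bigD1 i) //= e mul0r mulr0.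
  have tP i : t i = i \/ (i \in c) && (s i == t i).
    have := fac i; case: (i =P t i) => [<- | _]; first by left.
    by case: (_ && _); [right | rewrite subr0 eqxx].
  have [i0 ni0] : exists i, t i != i.
    apply/existsP; apply: contraR nt; rewrite negb_exists => /forallP h.
    by apply/eqP/permP=> i; rewrite perm1; apply/eqP; have := h i; rewrite negbK.
  have /andP[i0c _] : (i0 \in c) && (s i0 == t i0).
    by case: (tP i0) => // e; rewrite e eqxx in ni0.
  (* If t sends j to s j, injectivity forbids it to fix s j; hence t follows s all around the
     cycle. *)
  have ts m : t ((s ^+ m)%g i0) = s ((s ^+ m)%g i0).
    elim: m => [|m IH].
      rewrite expg0 perm1; case: (tP i0) => [e | /andP[_ /eqP //]].
      by rewrite e eqxx in ni0.
    have jc : (s ^+ m)%g i0 \in c.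
      by rewrite -eq_porbit_mem porbit_perm eq_porbit_mem.
    rewrite expgSr permM; set j := (s ^+ m)%g i0 in IH jc *.
    case: (tP (s j)) => [e | /andP[_ /eqP //]].
    by have := nsc _ jc; rewrite -(inj_eq (@perm_inj _ t)) e IH eqxx.
  case/eqP: nt0; apply/permP=> i; rewrite s0E; case: ifP => ic.
    have : i \in porbit s i0.
      by rewrite -eq_porbit_mem; move: ic i0c; rewrite -!eq_porbit_mem => /eqP -> /eqP ->.
    by move=> /porbitP[m ->].
  by case: (tP i) => //; rewrite ic.
(* The indicator vector of the cycle lies in the kernel. Over a commutative ring the adjugate turns
   this into det = 0, read at coordinate k, where the vector is 1. *)
have : \det (1%:M - partial_perm_mx (fun=> 1) c) = 0.
  pose v : 'cV[R]_n := \col_i (i \in c)%:R.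
  have Av : (1%:M - partial_perm_mx (fun=> 1) c) *m v = 0.
    apply/matrixP=> i j; rewrite mulmxBl mul1mx !mxE (bigD1 (s i)) //= big1 => [|l nl].
      by rewrite !mxE eqxx andbT cS addr0; case: (i \in c); rewrite ?mulr1 ?mul0r subrr.
    by rewrite !mxE eq_sym (negPf nl) andbF mul0r.
  have := congr1 (mulmx (\adj (1%:M - partial_perm_mx (fun=> 1) c))) Av.
  rewrite mulmxA mul_adj_mx mulmx0 mul_scalar_mx => /matrixP/(_ k 0).
  by rewrite !mxE porbit_id mulr1.
rewrite !detE big1 // mulr1 addrC => /eqP; rewrite addr_eq0 => /eqP ->.
by rewrite mulN1r.
Qed.

Lemma det_weighted_perm d :
  \det (1%:M - \matrix_(i, j) (d i *+ (s i == j))) =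
  \prod_(c in porbits s) (1 - \prod_(i in c) d i).
Proof.
have key (cs : seq {set 'I_n}) : uniq cs -> {subset cs <= porbits s} ->
    \det (1%:M - partial_perm_mx d (\bigcup_(c <- cs) c)) =
    \prod_(c <- cs) (1 - \prod_(i in c) d i).
  elim: cs => [_ _ | c cs IH /= /andP[ncs u_cs] sub].
    rewrite !big_nil (_ : partial_perm_mx _ _ = 0) ?subr0 ?det1 //.
    by apply/matrixP=> i j; rewrite !mxE inE.
  have cP : c \in porbits s by apply: sub; rewrite inE eqxx.
  rewrite !big_cons -partial_perm_mxU.
  - rewrite det_mulmx IH //; last by move=> c' c'P; apply: sub; rewrite inE c'P orbT.
    by case/imsetP: cP => k _ ->; rewrite det_cycle.
  - apply/pred0P => i; apply/negP => /andP[/= ic]; rewrite bigcup_seq => /bigcupP[c' c'cs ic'].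
    have c'P : c' \in porbits s by apply: sub; rewrite inE c'cs orbT.
    case/negP: ncs; move: ic ic'; rewrite -{1}(porbit_class cP) -{1}(porbit_class c'P) !inE.
    by move=> /eqP <- /eqP ->.
  - by case/imsetP: cP => k _ -> i; apply: porbit_stable.
have <- : partial_perm_mx d (\bigcup_(c <- enum (porbits s)) c) = \matrix_(i, j) (d i *+ (s i == j)).
  apply/matrixP=> i j; rewrite !mxE bigcup_seq (_ : i \in _ = true) //.
  apply/bigcupP; exists (porbit s i); last exact: porbit_id.
  by rewrite mem_enum imset_f.
rewrite key ?enum_uniq //; first by rewrite big_enum.
by move=> c; rewrite mem_enum.
Qed.

End WeightedPermutation.

(** * Sums over sign changes *)

Section SignSums.
Variables (K : fieldType) (n : nat).
Hypothesis two_neq0 : 2%:R != 0 :> K.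
Local Notation signs := {ffun 'I_n -> bool}.
Implicit Types (e : signs) (s : 'S_n).

Lemma SPerm_WD e s : (SPerm e s \in WD n) = ~~ (\big[addb/false]_i e i).
Proof. by rewrite inE odd_nb_sign_changes. Qed.

Lemma even_signs_indicator e :
  (~~ (\big[addb/false]_i e i))%:R = (1 + \prod_i (-1) ^+ e i) / 2%:R :> K.
Proof.
have <- : (-1) ^+ (\big[addb/false]_i e i) = \prod_i (-1) ^+ e i :> K.
  by rewrite (big_morph (fun b : bool => (-1) ^+ b : K) (@signr_addb K) (expr0 _ : (-1) ^+ false = 1 :> K)).
by case: (\big[_/_]_i _); rewrite /= ?expr0 ?expr1 ?subrr ?mul0r // -[1 + 1]/2%:R divff.
Qed.

Lemma sum_signs (F : 'I_n -> bool -> K) :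
  \sum_(e : signs) \prod_i F i (e i) = \prod_i (F i true + F i false).
Proof.
rewrite -(bigA_distr_bigA F); apply: eq_bigr => i _.
by rewrite big_bool.
Qed.

Lemma sum_even_signs : (0 < n)%N ->
  \sum_(e : signs) (~~ (\big[addb/false]_i e i))%:R = 2%:R ^+ n / 2%:R :> K.
Proof.
move=> n0; under eq_bigr do rewrite even_signs_indicator.
rewrite -big_distrl; congr (_ / _); rewrite big_split /= (sum_signs (fun _ b => (-1) ^+ b)).
rewrite sumr_const card_ffun card_bool card_ord natrX.
by rewrite [X in _ + X](_ : _ = 0) ?addr0 // (bigD1 (Ordinal n0)) //= addNr mul0r.
Qed.

Lemma detE_porbits (q : K) e s :
  detE q (SPerm e s) = \prod_(c in porbits s) (1 - \prod_(i in c) (q * (-1) ^+ e i)).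
Proof.
rewrite -det_weighted_perm /detE; congr (\det (_ - _)).
by apply/matrixP=> i j; rewrite !mxE /= mulrnAr.
Qed.

(** In the Leibniz expansion the sign of each row is summed independently, which cancels the entry
    of w and doubles that of the identity; det(2) remains. *)
Lemma sum_detE1 s : \sum_(e : signs) detE 1 (SPerm e s) = 2%:R ^+ n :> K.
Proof.
rewrite exchange_big /=.
transitivity (\sum_(t : 'S_n) (-1) ^+ odd_perm t * \prod_i (2%:R * (i == t i)%:R) : K).
  apply: eq_bigr => t _; rewrite -big_distrr; congr (_ * _).
  under eq_bigr do under eq_bigr do rewrite !mxE /= mul1r.
  rewrite (sum_signs (fun i b => (i == t i)%:R - (-1) ^+ b *+ (s i == t i))).
  apply: eq_bigr => i _; rewrite expr0 expr1 mulNrn opprK addrACA subrr addr0.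
  by rewrite -mulr2n mulr_natl.
have <- : \det (2%:R%:M : 'M[K]_n) = 2%:R ^+ n by rewrite det_scalar.
by apply: eq_bigr => t _; congr (_ * _); apply: eq_bigr => i _; rewrite !mxE mulr_natr.
Qed.

(* det(1 - w) vanishes unless every cycle of w is negative, and then
   det(1 - q w) and the parity of w depend only on the permutation s. *)
Lemma sum_even_detE (q : K) s :
    (forall c, c \in porbits s -> 1 + q ^+ #|c| != 0) ->
  \sum_(e : signs) (SPerm e s \in WD n)%:R * (detE 1 (SPerm e s) / detE q (SPerm e s)) =
  2%:R ^+ n / 2%:R * (1 + (-1) ^+ #|porbits s|) *
    \prod_(c in porbits s) (1 + q ^+ #|c|)^-1.
Proof.
(* Writing 2^n as the sum of all det(1 - w) over s reduces the claim to one identity per sign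
   vector: either det(1 - w) = 0 on both sides, or all cycles are negative. *)
move=> q1; rewrite -(sum_detE1 s) !big_distrl /=; apply: eq_bigr => e _.
have prodE x (c : {set 'I_n}) :
    \prod_(i in c) (x * (-1) ^+ e i) = x ^+ #|c| * \prod_(i in c) (-1) ^+ e i :> K.
  by rewrite big_split /= prodr_const.
have sgnE (c : {set 'I_n}) : \prod_(i in c) (-1) ^+ e i = 1 :> K \/
    \prod_(i in c) (-1) ^+ e i = -1 :> K.
  apply: (big_ind (fun x : K => x = 1 \/ x = -1)); first by left.
    by move=> _ _ [-> | ->] [-> | ->]; rewrite ?mulr1 ?mul1r ?mulrNN ?mulr1; [left | right | right | left].
  by move=> i _; case: (e i); [right | left].
have [[c cP c1] | neg] : (exists2 c, c \in porbits s & \prod_(i in c) (-1) ^+ e i = 1 :> K) \/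
    (forall c, c \in porbits s -> \prod_(i in c) (-1) ^+ e i = -1 :> K).
  case: (pickP [pred c in porbits s | \prod_(i in c) (-1) ^+ e i == 1 :> K]) => [c /andP[cP /eqP c1] | none].
    by left; exists c.
  right=> c cP; case: (sgnE c) => // c1.
  by have := none c; rewrite /= cP c1 eqxx.
  have -> : detE 1 (SPerm e s) = 0 :> K.
    by rewrite detE_porbits (bigD1 c) //= prodE c1 expr1n mulr1 subrr mul0r.
  by rewrite !mul0r mulr0.
rewrite SPerm_WD even_signs_indicator (prod_porbits s) (eq_bigr (fun=> -1)) // prodr_const.
rewrite (_ : detE q _ = \prod_(c in porbits s) (1 + q ^+ #|c|)); last first.
  by rewrite detE_porbits; apply: eq_bigr => c cP; rewrite prodE neg // mulrN1 opprK.
rewrite prodfV; set A := 1 + _; set B := detE _ _; set C := \prod_(c in _) _.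
by rewrite mulrA; congr (_ / _); rewrite mulrC -mulrA; congr (_ * _); rewrite mulrC.
Qed.

Lemma sum_sperm (F : sperm n -> K) :
  \sum_(w in WD n) F w = \sum_s \sum_(e : signs) (SPerm e s \in WD n)%:R * F (SPerm e s).
Proof.
rewrite pair_big /= big_mkcond /=.
rewrite (reindex (fun p : 'S_n * signs => SPerm p.2 p.1)) /=; last first.
  by exists (fun w => (sperm_perm w, sperm_sign w)) => [[s e] | [e s]].
by apply: eq_bigr => p _; case: ifP; rewrite ?mul1r ?mul0r.
Qed.

Lemma card_WD : (0 < n)%N -> #|WD n|%:R = n`!%:R * (2%:R ^+ n / 2%:R) :> K.
Proof.
move=> n0; rewrite -sum1_card natr_sum sum_sperm.
under eq_bigr do under eq_bigr do rewrite mulr1 SPerm_WD.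
by rewrite sum_even_signs // sumr_const card_Sn mulr_natl.
Qed.

End SignSums.

(** * The elliptic fake degree *)

Lemma mem_boxes la i j : ((i, j) \in boxes la) = (j < nth 0 la i)%N.
Proof.
apply/allpairsPdep/idP => [[i' [j' [_ + [-> ->]]]] | ji]; first by rewrite mem_iota.
exists i, j; split=> //; rewrite mem_iota //= add0n.
by case: ltnP => // ?; rewrite nth_default in ji.
Qed.

Lemma uniq_boxes la : uniq (boxes la).
Proof.
apply: allpairs_uniq_dep => [|i _|[a b] [c d] _ _ /= [-> ->] //]; exact: iota_uniq.
Qed.

Lemma perm_boxes_conj n la : is_partition n la ->
  perm_eq (boxes (conj_part la)) [seq (b.2, b.1) | b <- boxes la].
Proof.
move=> hla; apply: uniq_perm; first exact: uniq_boxes.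
  by rewrite map_inj_uniq ?uniq_boxes // => -[a b] [c d] [-> ->].
move=> [i j]; rewrite mem_boxes (nth_conj_part hla) (lt_height hla) -mem_boxes.
by apply/idP/mapP => [ji | [[a b] ab [-> ->]] //]; exists (j, i).
Qed.

Lemma n_stat_boxes la : n_stat la = (\sum_(b <- boxes la) b.1)%N.
Proof.
rewrite (big_boxes (N := size la)) // (n_statE (N := size la)) //.
by apply: eq_bigr => i _; rewrite sum_nat_const card_ord mulnC.
Qed.

Lemma n_stat_conj n la : is_partition n la ->
  n_stat (conj_part la) = (\sum_(b <- boxes la) b.2)%N.
Proof.
by move=> hla; rewrite n_stat_boxes (perm_big _ (perm_boxes_conj hla)) big_map.
Qed.

Lemma size_boxes n la : is_partition n la -> size (boxes la) = n.
Proof.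
move=> hla; rewrite -sum1_size (big_boxes (N := size la)) //.
rewrite -[RHS](sum_partition hla (leqnSn _)).
by apply: eq_bigr => i _; rewrite sum1_card card_ord.
Qed.

Section GenericFakeDegree.
Variables (K : fieldType) (q : K).
Hypothesis q_neq0 : q != 0.
Hypothesis q_free : forall k, (0 < k)%N -> 1 - q ^+ k != 0.
Variables (n : nat) (la : seq nat).
Hypothesis hla : is_partition n la.
Variable emb : {rmorphism algC -> K}.

Lemma add1_q_neq0 k : (0 < k)%N -> 1 + q ^+ k != 0.
Proof.
move=> k0; have := q_free (k := k * 2); rewrite muln_gt0 k0 => /(_ isT).
by rewrite exprM -{1}[1](expr1n K 2) subr_sqr mulf_eq0 negb_or => /andP[].
Qed.

Lemma exprz_sub (x : K) (a b : nat) : x != 0 -> x ^ (a%:Z - b%:Z) = x ^+ a / x ^+ b.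
Proof. by move=> x0; rewrite expfzDr // -invr_expz -!exprnP. Qed.

(** The n boxes absorb (-1)^n and q^n, and the identity holds box by box: at the box (i, j) of [la]
    both factors equal q^(2i+1) - q^(2j). *)
Lemma conj_content_prod :
  (-1) ^+ n * q ^+ (2 * n_stat (conj_part la)) *
     \prod_(b <- boxes (conj_part la)) (1 - q ^ (2%:Z * content b + 1)) =
  q ^+ n * (q ^+ (2 * n_stat la) *
     \prod_(b <- boxes la) (1 - q^-1 * (q ^+ 2) ^ content b)).
Proof.
rewrite (perm_big _ (perm_boxes_conj hla)) big_map (n_stat_conj hla) n_stat_boxes.
have constP (x : K) : x ^+ n = \prod_(b <- boxes la) x.
  by rewrite big_const_seq count_predT (size_boxes hla) -Monoid.iteropE.
rewrite !big_distrr /= -!prodrXr !constP -!big_split; apply: eq_bigr => -[i j] _ /=.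
rewrite /content /= exprz_sub ?expf_neq0 // -!exprM.
have -> : 2%:Z * (i%:Z - j%:Z) + 1 = (2 * i + 1)%N%:Z - (2 * j)%N%:Z by lia.
rewrite exprz_sub // exprD expr1.
have i0 : q ^+ (2 * i) != 0 by rewrite expf_neq0.
have j0 : q ^+ (2 * j) != 0 by rewrite expf_neq0.
by field; rewrite i0 j0 q_neq0.
Qed.

(* The two terms are the specializations t = q and t = q^-1, over q^2. *)
Lemma even_specht_sum :
  (\sum_(s : 'S_n) emb (specht_char la s) *
     ((1 + (-1) ^+ #|porbits s|) * \prod_(c in porbits s) (1 + q ^+ #|c|)^-1)) *
    \prod_(b <- boxes la) (1 - q ^+ (2 * hook la b)) =
  n`!%:R * (q ^+ (2 * n_stat la) *
     \prod_(b <- boxes la) (1 - q ^ (2%:Z * content b + 1)) +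
   (-1) ^+ n * q ^+ (2 * n_stat (conj_part la)) *
     \prod_(b <- boxes (conj_part la)) (1 - q ^ (2%:Z * content b + 1))).
Proof.
have q2_neq0 : q ^+ 2 != 0 by rewrite expf_neq0.
have q2_free k : (0 < k)%N -> 1 - (q ^+ 2) ^+ k != 0.
  by move=> k0; rewrite -exprM q_free // muln_gt0.
have spec := specht_char_specialization q2_neq0 q2_free hla emb.
rewrite conj_content_prod mulrDr [X in _ + X]mulrCA.
have -> : q ^+ (2 * n_stat la) * \prod_(b <- boxes la) (1 - q ^ (2%:Z * content b + 1)) =
    (q ^+ 2) ^+ n_stat la * \prod_(b <- boxes la) (1 - q * (q ^+ 2) ^ content b).
  rewrite exprM; congr (_ * _); apply: eq_bigr => b _.
  by rewrite expfzDr // expr1z mulrC exprnP exprz_exp.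
rewrite exprM -!spec mulrA -mulrDl; congr (_ * _); last first.
  by apply: eq_bigr => b _; rewrite exprM.
rewrite big_distrr -big_split; apply: eq_bigr => s _ /=.
rewrite [q ^+ n * _]mulrCA -mulrDr; congr (_ * _); rewrite mulrDl mul1r.
have gt0 c : c \in porbits s -> (0 < #|c|)%N.
  by move=> /imsetP[k _ ->]; rewrite lt0n card_porbit_neq0.
congr (_ + _).
  apply: eq_bigr => c /gt0 c0; have := q_free c0; have := add1_q_neq0 c0.
  rewrite exprAC => p0 m0; field.
  by rewrite p0 -{1}[1](expr1n K 2) subr_sqr mulf_neq0.
(* Spread over the cycles, q^n turns each factor into q^m (1 - q^(-m)) / (1 - q^(2m)) = -1 / (1 +
   q^m). *)
have -> : q ^+ n = \prod_(c in porbits s) q ^+ #|c|.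
  by rewrite prodrXr sum_card_porbits.
rewrite -prodr_const -!big_split /=.
apply: eq_bigr => c /gt0 c0; have := q_free c0; have := add1_q_neq0 c0.
rewrite exprAC exprVn => p0 m0; field.
by rewrite p0 -{1}[1](expr1n K 2) subr_sqr mulf_neq0 ?expf_neq0.
Qed.

Lemma natr_neq0_algC k : (0 < k)%N -> k%:R != 0 :> K.
Proof. by move=> k0; rewrite -(rmorph_nat emb) fmorph_eq0 pnatr_eq0 -lt0n. Qed.

Lemma generic_fake_degree : (0 < n)%N ->
  (q - 1) ^+ n / #|WD n|%:R *
    (\sum_(w in WD n) emb (specht_char la (sperm_perm w)) * (detE 1 w / detE q w)) =
  (q - 1) ^+ n / \prod_(b <- boxes la) (1 - q ^+ (2 * hook la b)) *
  (q ^+ (2 * n_stat la) *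
     \prod_(b <- boxes la) (1 - q ^ (2%:Z * content b + 1)) +
   (-1) ^+ n * q ^+ (2 * n_stat (conj_part la)) *
     \prod_(b <- boxes (conj_part la)) (1 - q ^ (2%:Z * content b + 1))).
Proof.
move=> n0; have two0 : 2%:R != 0 :> K by apply: natr_neq0_algC.
rewrite card_WD // sum_sperm.
set H := \prod_(b <- boxes la) (1 - q ^+ (2 * hook la b)).
have H0 : H != 0.
  rewrite prodf_seq_neq0; apply/allP=> b _ /=; apply: q_free.
  by rewrite muln_gt0 /= /hook addn1.
have f0 : n`!%:R != 0 :> K by apply/natr_neq0_algC/fact_gt0.
have t0 : 2%:R ^+ n != 0 :> K by rewrite expf_neq0.
apply: (mulIf H0); rewrite [RHS]mulrAC divfK //.
apply: (mulfI f0); rewrite [RHS]mulrCA -even_specht_sum -/H.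
set S := \sum_s emb _ * _.
(* The factor 2^n / 2 produced by the sign sums cancels against the order n! 2^n / 2 of W(D_n). *)
rewrite (_ : \sum_s \sum_e _ = 2%:R ^+ n / 2%:R * S).
  by field; rewrite f0 t0 two0.
rewrite /S big_distrr; apply: eq_bigr => s _ /=.
rewrite [RHS]mulrCA [X in _ = _ * X]mulrA -(sum_even_detE two0) => [|c /imsetP[k _ ->]]; last first.
  by rewrite add1_q_neq0 ?lt0n ?card_porbit_neq0.
by rewrite big_distrr; apply: eq_bigr => e _; rewrite mulrCA.
Qed.

End GenericFakeDegree.

Lemma qq_neq0 : qq != 0.
Proof. by rewrite tofrac_eq0 polyX_eq0. Qed.

Lemma qq_free k : (0 < k)%N -> 1 - qq ^+ k != 0.
Proof.
move=> k0; rewrite -rmorphXn -(rmorph1 (@FracField.tofrac _)) -rmorphB tofrac_eq0.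
by rewrite -oppr_eq0 opprB -size_poly_eq0 size_XnsubC.
Qed.

(** The map [constK] with its ring morphism structure, to serve as [emb]. *)
Definition constK_morphism : {rmorphism algC -> Kq} :=
  (@FracField.tofrac _ \o @polyC algC)%FUN.

Theorem proposition2p14 (n : nat) (la : seq nat)
    (hn : (2 <= n)%N) (hla : is_partition n la) :
  ell_fake_degree (ell_class (repr_vchar (part_empty_repr_D n la))) =
  (qq - 1) ^+ n / \prod_(b <- boxes la) (1 - qq ^+ (2 * hook la b)) *
  (qq ^+ (2 * n_stat la) *
     \prod_(b <- boxes la) (1 - qq ^ (2%:Z * content b + 1)) +
   (-1) ^+ n * qq ^+ (2 * n_stat (conj_part la)) *
     \prod_(b <- boxes (conj_part la)) (1 - qq ^ (2%:Z * content b + 1))).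
Proof.
rewrite ell_fake_degreeE /fake_degree_sum.
rewrite -(generic_fake_degree qq_neq0 qq_free hla constK_morphism (ltnW hn)).
congr (_ * _); apply: eq_bigr => w Ww; congr (_ * _).
(* Inflation and restriction do not change matrices, so the character at w unfolds to
   [specht_char la (sperm_perm w)]. *)
by rewrite /= cfunE Ww mulr1n.
Qed.
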